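(* Let $R>0$, let $B_R$ and $B_{2R}$ be concentric open balls with $B_{2R}\subset\Omega$, let $\kappa\in(0,\alpha_{\min}/\alpha_{\max})$ be arbitrarily small, let $$0<\gamma<\frac{\alpha_{\min}}{\alpha_{\max}}-\kappa,$$ and let $0<\varepsilon<1$. If $u$ satisfies $$u(x)=\frac12\Big[\sup_{|\nu|=\varepsilon}W(u;x,\nu)+\inf_{|\nu|=\varepsilon}W(u;x,\nu)\Big]\qquad\text{for all }x\in\Omega\setminus I_\varepsilon,$$ then for all $(x,z)\in B_R\times B_R$ $$|u(x)-u(z)|\le C\frac{|x-z|^\gamma}{R^\gamma}+C\frac{\varepsilon^\gamma}{R^\gamma},$$ where the constant $C$ depends only on $p_{\min},p_{\max},n,R,\sup_{B_{2R}}|u|$ and $\gamma$.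
   Context: $n\ge2$ is an integer, $\Omega\subset\mathbb R^n$ is a bounded domain, and $I_\varepsilon=\{x\in\Omega:\operatorname{dist}(x,\partial\Omega)<\varepsilon\}$. $p:\overline\Omega\to\mathbb R$ is continuous with $1<p_{\min}:=\inf_\Omega p\le\sup_\Omega p=:p_{\max}<\infty$. For $x\in\overline\Omega$, $\alpha(x)=\frac{p(x)-1}{p(x)+n}$ and $\beta(x)=1-\alpha(x)=\frac{n+1}{p(x)+n}$; $\alpha_{\min}:=\inf_\Omega\alpha>0$, $\alpha_{\max}:=\sup_\Omega\alpha<1$. For $\nu\neq0$, $B_\varepsilon^\nu=\{z\in\mathbb R^n:|z|<\varepsilon,\ \langle z,\nu\rangle=0\}$, $\mathcal L^{n-1}$ is $(n-1)$-dimensional Lebesgue measure, and $$W(u;x,\nu)=\alpha(x)u(x+\nu)+\beta(x)\frac1{\mathcal L^{n-1}(B_\varepsilon^\nu)}\int_{B_\varepsilon^\nu}u(x+h)\,d\mathcal L^{n-1}(h).$$ Here $u:\overline\Omega\to\mathbb R$ is a measurable function for which these expressions are well defined. *)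

(* Defs.v *)
From HB Require Import structures.
From mathcomp Require Import all_boot all_order all_algebra.
From mathcomp Require Import all_classical all_reals all_analysis.
Set Implicit Arguments.
Unset Strict Implicit.
Unset Printing Implicit Defensive.
Import Order.TTheory GRing.Theory Num.Theory.
Import numFieldNormedType.Exports.
Local Open Scope classical_set_scope.
Local Open Scope ring_scope.

Section tuple_lebesgue.
Context {R : realType}.
Local Notation T := (measurableTypeR R).

Definition tcons m (x : T * m.-tuple T) : m.+1.-tuple T :=
  [tuple of x.1 :: x.2].

Lemma measurable_tcons m : measurable_fun [set: T * m.-tuple T] (@tcons m).
Proof. exact: (measurable_cons measurable_fst measurable_snd). Qed.

Section step.
Context m (mu : {sigma_finite_measure set (m.-tuple T) -> \bar R}).

Definition tuple_lebesgueS : set (m.+1.-tuple T) -> \bar R :=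
  pushforward (lebesgue_measure \x mu)%E (@tcons m).

HB.instance Definition _ := Measure.copy tuple_lebesgueS
  (measure_function_pushforward__canonical__measure_function_Measure
     (lebesgue_measure \x mu)%E (@measurable_tcons m)).

Let tuple_lebesgueS_sigma_finite : sigma_finite setT tuple_lebesgueS.
Proof.
have /sigma_finiteP[F [TF ndF Foo]] := sigma_finiteT (@lebesgue_measure R).
have /sigma_finiteP[G [TG ndG Goo]] := sigma_finiteT mu.
pose tuncons (t : m.+1.-tuple T) : T * m.-tuple T :=
  (thead t, [tuple of behead t]).
have tconsK : cancel (@tcons m) tuncons.
  by case=> a t; rewrite /tuncons/= theadE; congr pair; exact: val_inj.
have mtuncons : measurable_fun [set: m.+1.-tuple T] tuncons.
  by apply: measurable_fun_pair; [exact: measurable_tnth|exact: measurable_behead].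
exists (fun k => tuncons @^-1` (F k `*` G k)).
  rewrite -preimage_bigcup (_ : \bigcup_k _ = setT) ?preimage_setT//.
  rewrite -subTset => -[x y] _.
  have [k _ Fx] : (\bigcup_k F k) x by rewrite -TF.
  have [l _ Gy] : (\bigcup_k G k) y by rewrite -TG.
  exists (maxn k l) => //; split.
    by move: Fx; exact/subsetPset/ndF/leq_maxl.
  by move: Gy; exact/subsetPset/ndG/leq_maxr.
move=> k; have [mF Fk] := Foo k; have [mG Gk] := Goo k; split.
  by rewrite -[X in measurable X]setTI; apply: mtuncons => //; exact: measurableX.
rewrite /tuple_lebesgueS /pushforward -comp_preimage.
rewrite (_ : tuncons \o _ = idfun) ?preimage_id; last exact/funext.
by rewrite product_measure1E// lte_mul_pinfty// ge0_fin_numE.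
Qed.

HB.instance Definition _ := Measure_isSigmaFinite.Build _ _ _ tuple_lebesgueS
  tuple_lebesgueS_sigma_finite.

End step.

(* The Lebesgue measure of R^m on the product (Borel) sigma-algebra, as an
   iterated product of the one-dimensional one. *)
Fixpoint tuple_lebesgue m : {sigma_finite_measure set (m.-tuple T) -> \bar R} :=
  if m is m'.+1 then tuple_lebesgueS (tuple_lebesgue m') else \d_[tuple].

End tuple_lebesgue.

Section image_outer.
Context {R : realType} (T1 T2 : Type).
Variables (mu : {outer_measure set T1 -> \bar R}) (f : T1 -> T2).
Local Open Scope ereal_scope.

Definition image_outer (A : set T2) : \bar R := mu (f @^-1` A).

Let image_outer0 : image_outer set0 = 0.
Proof. by rewrite /image_outer preimage_set0 outer_measure0. Qed.

Let image_outer_ge0 A : 0 <= image_outer A.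
Proof. exact: outer_measure_ge0. Qed.

Let le_image_outer : {homo image_outer : A B / A `<=` B >-> A <= B}.
Proof. by move=> A B AB; apply: le_outer_measure => x; exact: AB. Qed.

Let image_outer_sigma_subadditive : sigma_subadditive image_outer.
Proof.
move=> F; rewrite /image_outer preimage_bigcup.
exact: outer_measure_sigma_subadditive.
Qed.

HB.instance Definition _ := isOuterMeasure.Build R T2 image_outer
  image_outer0 image_outer_ge0 le_image_outer image_outer_sigma_subadditive.

End image_outer.

Section euclidean_space.
Context {R : realType}.

(* The library norm on 'rV[R]_n is the maximum norm; this one is Euclidean. *)
Definition enorm n (x : 'rV[R]_n) : R := Num.sqrt (\sum_(i < n) x 0 i ^+ 2).

Definition dotp n (x y : 'rV[R]_n) : R := \sum_(i < n) x 0 i * y 0 i.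

Definition eball n (c : 'rV[R]_n) (r : R) : set 'rV[R]_n :=
  [set x | enorm (x - c) < r].

Definition boundary n (A : set 'rV[R]_n) : set 'rV[R]_n :=
  closure A `\` interior A.

Definition edist n (x : 'rV[R]_n) (A : set 'rV[R]_n) : R :=
  inf [set enorm (x - y) | y in A].

(* Lebesgue outer measure on R^m; its Caratheodory measurable sets are the
   Lebesgue measurable sets (the completion of the Borel ones). *)
Definition lebesgue_outer m : set 'rV[R]_m -> \bar R :=
  image_outer ((tuple_lebesgue m)^*)%mu
    (fun t : m.-tuple R => \row_(i < m) tnth t i).

HB.instance Definition _ m := OuterMeasure.on (@lebesgue_outer m).

Definition lebesgue_measurable_fun n (D : set 'rV[R]_n) (f : 'rV[R]_n -> R) :=
  measurable_fun (D : set (caratheodory_type (@lebesgue_outer n))) f.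

(* The rows of [frame nu] are an orthonormal basis of the hyperplane
   orthogonal to nu (if nu != 0). *)
Definition frame n (nu : 'rV[R]_n) : 'M[R]_(n.-1, n) :=
  xget 0 [set Q : 'M[R]_(n.-1, n) | Q *m Q^T = 1%:M /\ Q *m nu^T = 0].

(* The (n-1)-dimensional Lebesgue measure of the hyperplane orthogonal to nu,
   as a measure on R^n carried by that hyperplane: the image of the Lebesgue
   measure of R^(n-1) under the isometry y |-> y *m frame nu.  By rotation
   invariance it does not depend on the chosen basis. *)
Definition hyperplane_outer n (nu : 'rV[R]_n) : set 'rV[R]_n -> \bar R :=
  image_outer (@lebesgue_outer n.-1) (fun y => y *m frame nu).

HB.instance Definition _ n (nu : 'rV[R]_n) :=
  OuterMeasure.on (hyperplane_outer nu).

Definition hyperplane_lebesgue n (nu : 'rV[R]_n) :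
    set (caratheodory_type (hyperplane_outer nu)) -> \bar R :=
  hyperplane_outer nu.
Arguments hyperplane_lebesgue {n} nu.

HB.instance Definition _ n (nu : 'rV[R]_n) :=
  isMeasure.Build _ _ _ (hyperplane_lebesgue nu)
    (@caratheodory_measure0 _ _ (hyperplane_outer nu))
    (@caratheodory_measure_ge0 _ _ (hyperplane_outer nu))
    (@caratheodory_measure_sigma_additive _ _ (hyperplane_outer nu)).

Definition hyperplane_ball n (eps : R) (nu : 'rV[R]_n) : set 'rV[R]_n :=
  [set z | enorm z < eps /\ dotp z nu = 0].

End euclidean_space.
Arguments hyperplane_lebesgue {R n} nu.

Section tug_of_war.
Context {R : realType} {n : nat}.
Implicit Types (Omega : set 'rV[R]_n) (p u : 'rV[R]_n -> R) (x nu : 'rV[R]_n).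

Definition domain Omega := [/\ Omega !=set0, open Omega & connected Omega].

(* I_eps *)
Definition boundary_strip Omega (eps : R) : set 'rV[R]_n :=
  [set x | Omega x /\ edist x (boundary Omega) < eps].

Definition alpha p x : R := (p x - 1) / (p x + n%:R).

Definition beta p x : R := 1 - alpha p x.

Definition alpha_min Omega p : R := inf [set alpha p x | x in Omega].

Definition alpha_max Omega p : R := sup [set alpha p x | x in Omega].

Definition W p (eps : R) u x nu : R :=
  alpha p x * u (x + nu) +
  beta p x * ((fine (hyperplane_lebesgue nu (hyperplane_ball eps nu)))^-1 *
    \int[hyperplane_lebesgue nu]_(h in hyperplane_ball eps nu) u (x + h)).

Definition W_well_defined (eps : R) u x nu : Prop :=
  (hyperplane_lebesgue nu).-integrable (hyperplane_ball eps nu)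
    (fun h => (u (x + h))%:E).

(* The supremum and the infimum are taken in the extended reals, so the
   equation forces both to be finite. *)
Definition satisfies_dpp Omega p (eps : R) u : Prop :=
  forall x, (Omega `\` boundary_strip Omega eps) x ->
    (u x)%:E = ((2^-1)%:E *
      (ereal_sup [set (W p eps u x nu)%:E | nu in [set nu | enorm nu = eps]] +
       ereal_inf [set (W p eps u x nu)%:E | nu in [set nu | enorm nu = eps]]))%E.

End tug_of_war.

(* Main.v *)
(* Let f(x, z) = C |x - z|^gamma + D (|x - x1|^2 + |z - z1|^2) - f2(|x - z|),
   where (x1, z1) in B_R x B_R is the pair at which the estimate is wanted and
   f2 is a decreasing step function with maximum Lam^N eps^gamma, supported in
   [0, N eps].  Let K be the supremum of u(x) - u(z) - f(x, z) over
   B_2R x B_2R; it suffices that K <= Lam^N eps^gamma.  Otherwise a nearly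
   maximizing pair (x, z) has x <> z and is close to (x1, z1), and we insert the
   mean value equation at x and at z.  One player moves the points by nu_x and
   nu_z; the other one has a reply that makes f drop by at least eps^2 on
   average, which contradicts the choice of K:
   - if |x - z| <= N eps, pull the points together: f2 jumps by the factor Lam;
   - if |x - z| > N eps and nu_x, nu_z do not point almost radially apart, pull
     radially: the first order term of |x - z|^gamma decreases;
   - otherwise reply with -nu_x, -nu_z: the first order terms cancel, and up to
     a positive factor the second order term is at most
     - 4 (1 - gamma) min(alpha(x), alpha(z)) + gamma |alpha(x) - alpha(z)| < 0,
     since gamma alpha_max <= alpha_min.
   In the last case the two noises are coupled by the rotation that takes nu_x
   to - nu_z; this requires the mean over a hyperplane ball not to depend on the
   orthonormal basis, i.e. the rotation invariance of the Lebesgue measure. *)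

Require Import Defs.
From mathcomp Require Import all_boot all_order all_algebra.
From mathcomp Require Import all_classical all_reals all_analysis.
From mathcomp Require Import measurable_realfun ring lra zify.
Set Implicit Arguments.
Unset Strict Implicit.
Unset Printing Implicit Defensive.
Import Order.TTheory GRing.Theory Num.Theory.
Import numFieldNormedType.Exports.
Local Open Scope classical_set_scope.
Local Open Scope ring_scope.

(** * The Euclidean norm *)

Section euclidean_norm.
Context {R : realType} {n : nat}.
Implicit Types (x y z : 'rV[R]_n).

Lemma dotpE x y : dotp x y = (x *m y^T) 0 0.
Proof. by rewrite mxE; apply: eq_bigr => i _; rewrite mxE. Qed.

Lemma dotpC x y : dotp x y = dotp y x.
Proof. by apply: eq_bigr => i _; rewrite mulrC. Qed.

Lemma dotpDl x y z : dotp (x + y) z = dotp x z + dotp y z.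
Proof. by rewrite !dotpE mulmxDl mxE. Qed.

Lemma dotpDr x y z : dotp z (x + y) = dotp z x + dotp z y.
Proof. by rewrite dotpC dotpDl !(dotpC z). Qed.

Lemma dotpZl a x y : dotp (a *: x) y = a * dotp x y.
Proof. by rewrite !dotpE -scalemxAl mxE. Qed.

Lemma dotpZr a x y : dotp x (a *: y) = a * dotp x y.
Proof. by rewrite dotpC dotpZl dotpC. Qed.

Lemma dotpNl x y : dotp (- x) y = - dotp x y.
Proof. by rewrite -scaleN1r dotpZl mulN1r. Qed.

Lemma dotpNr x y : dotp x (- y) = - dotp x y.
Proof. by rewrite dotpC dotpNl dotpC. Qed.

Lemma dotp_ge0 x : 0 <= dotp x x.
Proof. by apply: sumr_ge0 => i _; rewrite -expr2 sqr_ge0. Qed.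

Lemma enorm_ge0 x : 0 <= enorm x.
Proof. exact: sqrtr_ge0. Qed.

Lemma sqr_enorm x : enorm x ^+ 2 = dotp x x.
Proof.
rewrite sqr_sqrtr; first by apply: eq_bigr => i _; rewrite expr2.
by apply: sumr_ge0 => i _; exact: sqr_ge0.
Qed.

Lemma enorm_sqrt x : enorm x = Num.sqrt (dotp x x).
Proof. by rewrite -sqr_enorm sqrtr_sqr ger0_norm ?enorm_ge0. Qed.

Lemma enorm_eq0 x : (enorm x == 0) = (x == 0).
Proof.
rewrite -sqrf_eq0 sqr_enorm psumr_eq0; last by move=> i _; rewrite -expr2 sqr_ge0.
apply/allP/eqP => [x0|-> i _]; last by rewrite mxE mulr0 eqxx.
apply/rowP => i; apply/eqP; rewrite mxE -sqrf_eq0 expr2.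
exact: (implyP (x0 i (mem_index_enum i))).
Qed.

Lemma enorm0 : enorm (0 : 'rV[R]_n) = 0.
Proof. by apply/eqP; rewrite enorm_eq0. Qed.

Lemma enorm_gt0 x : (0 < enorm x) = (x != 0).
Proof. by rewrite lt_def enorm_ge0 andbT enorm_eq0. Qed.

Lemma enormN x : enorm (- x) = enorm x.
Proof. by rewrite !enorm_sqrt dotpNl dotpNr opprK. Qed.

Lemma enormB x y : enorm (x - y) = enorm (y - x).
Proof. by rewrite -enormN opprB. Qed.

Lemma enormZ a x : enorm (a *: x) = `|a| * enorm x.
Proof.
rewrite !enorm_sqrt dotpZl dotpZr mulrA -expr2 sqrtrM ?sqr_ge0//.
by rewrite sqrtr_sqr.
Qed.

(** Cauchy-Schwarz, from the expansion of the square norm of |y| x - |x| y, which is 2 |x| |y| (|x|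
    |y| - x.y). *)
Lemma dotp_le x y : dotp x y <= enorm x * enorm y.
Proof.
have [->|y0] := eqVneq y 0.
  by rewrite enorm0 mulr0 /dotp big1// => i _; rewrite mxE mulr0.
have y1 : 0 < enorm y by rewrite enorm_gt0.
have := dotp_ge0 (enorm y *: x - enorm x *: y).
rewrite dotpDl !dotpDr !dotpNl !dotpNr !dotpZl !dotpZr (dotpC y x) -!sqr_enorm.
have [/eqP|x1] := eqVneq (enorm x) 0.
  rewrite enorm_eq0 => /eqP-> _; rewrite enorm0 /dotp big1 ?mul0r// => i _.
  by rewrite mxE mul0r.
have {x1} : 0 < enorm x by rewrite lt_def x1 enorm_ge0.
set a := enorm x in y1 *; set b := enorm y in y1 *; set d := dotp x y => a0 H.
have : 0 <= (2 * (a * b)) * (a * b - d) by nra.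
by rewrite pmulr_rge0 ?subr_ge0// !mulr_gt0.
Qed.

Lemma norm_dotp_le x y : `|dotp x y| <= enorm x * enorm y.
Proof.
rewrite ler_norml dotp_le andbT lerNl -dotpNl.
by rewrite (le_trans (dotp_le _ _))// enormN.
Qed.

Lemma enormD x y : enorm (x + y) <= enorm x + enorm y.
Proof.
rewrite -ler_sqr ?nnegrE ?addr_ge0 ?enorm_ge0//.
rewrite sqr_enorm dotpDl !dotpDr (dotpC y x) -!sqr_enorm.
have := dotp_le x y; nra.
Qed.

Lemma sqr_enormD x y :
  enorm (x + y) ^+ 2 = enorm x ^+ 2 + 2 * dotp x y + enorm y ^+ 2.
Proof.
by rewrite sqr_enorm dotpDl !dotpDr (dotpC y x) -!sqr_enorm; ring.
Qed.

Lemma enorm_delta i : enorm (delta_mx 0 i : 'rV[R]_n) = 1.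
Proof.
rewrite enorm_sqrt /dotp (bigD1 i)//= big1 => [|k /negPf kE].
  by rewrite !mxE !eqxx mulr1 addr0 sqrtr1.
by rewrite !mxE kE !andbF mulr0.
Qed.

End euclidean_norm.

Section euclidean_mulmx.
Context {R : realType}.

Lemma dotp_mulmxl m n (y : 'rV[R]_m) (P : 'M[R]_(m, n)) (z : 'rV[R]_n) :
  dotp (y *m P) z = dotp y (z *m P^T).
Proof. by rewrite !dotpE trmx_mul trmxK mulmxA. Qed.

Lemma enorm_mulmx m n (y : 'rV[R]_m) (P : 'M[R]_(m, n)) : P *m P^T = 1%:M ->
  enorm (y *m P) = enorm y.
Proof. by move=> P1; rewrite !enorm_sqrt dotp_mulmxl -mulmxA P1 mulmx1. Qed.

End euclidean_mulmx.

(** * Rotation invariance of the Lebesgue measure *)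

Section affine_invariance.
Context {R : realType}.
Local Notation T := (measurableTypeR R).

(** The measure structure of a pushforward depends on a proof of measurability, so it is built
    explicitly; the uniqueness theorems for measures can then be applied to it. *)
Definition pushforward_measure d1 d2 (T1 : measurableType d1)
    (T2 : measurableType d2) (mu : {measure set T1 -> \bar R}) (f : T1 -> T2)
    (mf : measurable_fun [set: T1] f) : {measure set T2 -> \bar R} :=
  measure_function_pushforward__canonical__measure_function_Measure mu mf.

Lemma pushforward_measureE d1 d2 (T1 : measurableType d1)
    (T2 : measurableType d2) (mu : {measure set T1 -> \bar R}) (f : T1 -> T2)
    (mf : measurable_fun [set: T1] f) A :
  pushforward_measure mu mf A = mu (f @^-1` A).
Proof. by []. Qed.

(** The hypothesis on s leaves s = 1 or s = -1. In both cases the preimage of ]a, b] is an interval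
    of the same length, and the measure is determined by its values on such intervals. *)
Lemma lebesgue_measure_affine (s v : R) (A : set T) : s ^+ 2 = 1 ->
  measurable A ->
  lebesgue_measure ((fun x : T => s * x + v : T) @^-1` A) = lebesgue_measure A.
Proof.
move=> s1 mA.
have mf : measurable_fun [set: T] (fun x : T => s * x + v : T).
  by apply: measurable_funD => //; apply: measurable_funM.
suff H : forall X, ocitv X -> lebesgue_measure X =
    pushforward_measure (@lebesgue_measure R) mf X.
  exact/esym/(lebesgue_measure_unique H).
move=> _ [[a b] _ <-]; rewrite pushforward_measureE.
have /orP[/eqP->|/eqP->] : (s == 1) || (s == -1) by rewrite -sqrf_eq1 s1.
- rewrite (_ : _ @^-1` _ = `]a - v, b - v]%classic).
    rewrite [LHS]lebesgue_measure_itv [RHS]lebesgue_measure_itv/= !lte_fin.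
    by rewrite ltrD2r; case: ifP => // _; rewrite -!EFinD; congr (_%:E); ring.
  by apply/seteqP; split => x /=; rewrite !in_itv/= => /andP[? ?];
    apply/andP; split; lra.
- rewrite (_ : _ @^-1` _ = `[v - b, v - a[%classic).
    rewrite [LHS]lebesgue_measure_itv [RHS]lebesgue_measure_itv/= !lte_fin.
    rewrite ltrD2l ltrN2.
    by case: ifP => // _; rewrite -!EFinD; congr (_%:E); ring.
  by apply/seteqP; split => x /=; rewrite !in_itv/= => /andP[? ?];
    apply/andP; split; lra.
Qed.

(** Used with s = 1 (translations) and s = -1 (point reflections); the swap argument for orthogonal
    maps needs both. *)
Definition tuple_affine m (s : R) (v : m.-tuple T) (t : m.-tuple T) : m.-tuple T :=
  [tuple (s * tnth t i + tnth v i : T) | i < m].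

Lemma measurable_tuple_affine m s (v : m.-tuple T) :
  measurable_fun [set: m.-tuple T] (tuple_affine s v).
Proof.
apply/measurable_fun_tnthP => i.
rewrite (_ : _ \o _ = fun t => s * tnth t i + tnth v i); last first.
  by apply/funext => t /=; rewrite tnth_mktuple.
apply: measurable_funD => //; apply: measurable_funM => //.
exact: measurable_tnth.
Qed.

Lemma tuple_lebesgue_affine m s (v : m.-tuple T) (A : set (m.-tuple T)) :
  s ^+ 2 = 1 -> measurable A ->
  tuple_lebesgue m (tuple_affine s v @^-1` A) = tuple_lebesgue m A.
Proof.
move=> s1; elim: m v A => [|m IH] v A mA.
  congr (tuple_lebesgue 0 _); apply/seteqP.
  by split => x /=; rewrite (tuple0 (tuple_affine _ _ _)) (tuple0 x).
have mf : measurable_fun [set: T] (fun x : T => s * x + thead v : T).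
  by apply: measurable_funD => //; apply: measurable_funM.
have mg : measurable_fun [set: T * m.-tuple T] (fun x : T * m.-tuple T =>
    (s * x.1 + thead v : T, tuple_affine s [tuple of behead v] x.2)).
  apply/measurable_fun_pairP; split.
    exact: (measurableT_comp mf measurable_fst).
  exact: (measurableT_comp (measurable_tuple_affine _ _) measurable_snd).
rewrite /= /tuple_lebesgueS /pushforward.
have mtA : measurable (@tcons R m @^-1` A).
  by rewrite -[X in measurable X]setTI; apply: measurable_tcons.
(* Read through [tcons], the map acts separately on head and tail. Uniqueness of the product measure
   then reduces the claim to rectangles, where the one-dimensional case and the induction hypothesis
   apply. *)
rewrite -(_ : pushforward_measure (lebesgue_measure \x tuple_lebesgue m)%E mg
    (@tcons R m @^-1` A) = (lebesgue_measure \x tuple_lebesgue m)%E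
    (@tcons R m @^-1` A)).
  rewrite pushforward_measureE; congr (product_measure1 _ _ _).
  apply/funext => -[a t]; congr A.
  apply: eq_from_tnth => i; rewrite !tnth_mktuple/=.
  case: (unliftP ord0 i) => [j ->|->].
    rewrite !tnthS tnth_mktuple; congr (_ + _).
    by rewrite [in LHS](tuple_eta v) tnthS.
  by rewrite !tnth0.
symmetry; apply: product_measure_unique => // B C mB mC.
rewrite pushforward_measureE.
rewrite (_ : _ @^-1` _ = ((fun x : T => s * x + thead v : T) @^-1` B) `*`
  (tuple_affine s [tuple of behead v] @^-1` C)) //.
apply: etrans (product_measure1E _ _ _ _) _; last first.
- by congr (_ * _)%E; [exact: lebesgue_measure_affine|exact: IH].
- have := @measurable_tuple_affine m s [tuple of behead v] measurableT C mC.
  by rewrite setTI.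
- by have := mf measurableT B mB; rewrite setTI.
Qed.

End affine_invariance.

(** * Orthogonal maps preserve Lebesgue measure *)

Section orthogonal_invariance.
Context {R : realType}.
Local Notation T := (measurableTypeR R).

Definition row_of_tuple m (t : m.-tuple R) : 'rV[R]_m := \row_(i < m) tnth t i.

Definition tuple_of_row m (x : 'rV[R]_m) : m.-tuple R := [tuple x 0 i | i < m].

Lemma row_of_tupleK m : cancel (@row_of_tuple m) (@tuple_of_row m).
Proof. by move=> t; apply: eq_from_tnth => i; rewrite tnth_mktuple mxE. Qed.

Lemma tuple_of_rowK m : cancel (@tuple_of_row m) (@row_of_tuple m).
Proof. by move=> x; apply/rowP => i; rewrite mxE tnth_mktuple. Qed.

Definition tuple_mulmx m (Q : 'M[R]_m) (t : m.-tuple T) : m.-tuple T :=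
  tuple_of_row (row_of_tuple t *m Q).

Lemma tuple_mulmxK m (Q : 'M[R]_m) : Q *m Q^T = 1%:M ->
  cancel (tuple_mulmx Q) (tuple_mulmx Q^T).
Proof.
move=> Q1 t; rewrite /tuple_mulmx tuple_of_rowK -mulmxA Q1 mulmx1.
exact: row_of_tupleK.
Qed.

Lemma measurable_tuple_mulmx m (Q : 'M[R]_m) :
  measurable_fun [set: m.-tuple T] (tuple_mulmx Q).
Proof.
apply/measurable_fun_tnthP => i.
rewrite (_ : _ \o _ = fun t => \sum_(j < m) tnth t j * Q j i); last first.
  apply/funext => t /=; rewrite tnth_mktuple mxE.
  by apply: eq_bigr => j _; rewrite mxE.
apply: measurable_sum => j; apply: measurable_funM => //.
exact: measurable_tnth.
Qed.

Definition tuple_ball m (e : R) : set (m.-tuple T) :=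
  [set t | enorm (row_of_tuple t) < e].

Lemma measurable_tuple_ball m e : measurable (@tuple_ball m e).
Proof.
have mf : measurable_fun [set: m.-tuple T] (fun t : m.-tuple T =>
    \sum_(i < m) tnth t i ^+ 2).
  apply: measurable_sum => i; apply: measurable_funX; exact: measurable_tnth.
have [e0|e0] := ltP 0 e; last first.
  rewrite (_ : tuple_ball _ = set0) //; apply/seteqP; split => // t /=.
  by rewrite /tuple_ball/= ltNge (le_trans e0 (sqrtr_ge0 _)).
have := mf measurableT `]-oo, (e ^+ 2)[%classic (measurable_itv _).
rewrite setTI (_ : _ @^-1` _ = @tuple_ball m e) //.
apply/funext => t; apply/propext; rewrite /tuple_ball/= in_itv/=.
rewrite -[X in _ <-> _ < X](gtr0_norm e0) -sqrtr_sqr ltr_sqrt ?exprn_gt0//.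
by rewrite (eq_bigr (fun i => row_of_tuple t 0 i ^+ 2))// => i _; rewrite mxE.
Qed.

Definition tuple_cube m (c : R) : set (m.-tuple T) :=
  [set t | forall i, `|tnth t i| <= c].

Lemma tuple_lebesgue_cube m c : 0 <= c ->
  measurable (@tuple_cube m c) /\
  tuple_lebesgue m (tuple_cube c) = ((2 * c) ^+ m)%:E.
Proof.
move=> c0; elim: m => [|m [mC IH]].
  rewrite (_ : tuple_cube c = setT); last first.
    by apply/seteqP; split => // t _ [].
  by split => //=; rewrite diracT expr0.
have mI : measurable (`[- c, c]%classic : set T) by exact: measurable_itv.
split.
  rewrite (_ : tuple_cube c = \bigcap_(k < m.+1)
      ((@tnth _ T ^~ (inord k)) @^-1` `[- c, c]%classic)).
    rewrite bigcap_mkord; apply: bigsetI_measurable => i _.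
    have := @measurable_tnth _ T m.+1 (inord i) measurableT _ mI.
    by rewrite setTI.
  apply/seteqP; split => t tc.
    by move=> i _; rewrite /= in_itv/= -ler_norml; exact: tc.
  move=> i; have := tc i (ltn_ord i); rewrite /= in_itv/= -ler_norml.
  by rewrite inord_val.
rewrite /= /tuple_lebesgueS /pushforward.
rewrite (_ : _ @^-1` _ = `[- c, c]%classic `*` tuple_cube c); last first.
  apply/seteqP; split => -[a t] /=.
    move=> H; split; first by rewrite in_itv/= -ler_norml; exact: (H ord0).
    by move=> i; have := H (lift ord0 i); rewrite tnthS.
  rewrite in_itv/= -ler_norml => -[ac tc] i.
  case: (unliftP ord0 i) => [j ->|->]; last by rewrite tnth0.
  by rewrite tnthS.
rewrite product_measure1E//= IH lebesgue_measure_itv/= lte_fin.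
rewrite exprS EFinM; congr (_ * _)%E.
case: ltP => [_|H]; first by rewrite -EFinD; congr (_%:E); ring.
by congr (_%:E); lra.
Qed.

(** The ball lies between two cubes. Positivity and finiteness are what allows cancelling the
    measure of the ball and dividing by it. *)
Lemma tuple_lebesgue_ball m e : 0 < e ->
  (0 < tuple_lebesgue m (tuple_ball e) < +oo)%E.
Proof.
move=> e0; apply/andP; split.
  (* The cube of half side c lies in the open ball because m c^2 < e^2, that is m < (m + 1)^2; this
     also covers m = 0. *)
  pose c := e / m.+1%:R.
  have c0 : 0 < c by rewrite divr_gt0.
  have [mC C] := tuple_lebesgue_cube m (ltW c0).
  apply: (@lt_le_trans _ _ (tuple_lebesgue m (tuple_cube c))).
    by rewrite C lte_fin exprn_gt0// mulr_gt0.
  apply: le_measure; rewrite ?inE//; first exact: measurable_tuple_ball.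
  move=> t tc; rewrite /tuple_ball/=.
  rewrite -[ltRHS](gtr0_norm e0) -sqrtr_sqr ltr_sqrt ?exprn_gt0//.
  apply: (@le_lt_trans _ _ (\sum_(i < m) c ^+ 2)).
    apply: ler_sum => i _; rewrite mxE -real_normK ?num_real//.
    by rewrite ler_sqr ?nnegrE// ltW.
  rewrite sumr_const card_ord /c expr_div_n -[ltLHS]mulr_natr -mulrA.
  rewrite gtr_pMr ?exprn_gt0// mulrC ltr_pdivrMr ?exprn_gt0// mul1r.
  by rewrite -natrX ltr_nat; lia.
have [mC C] := tuple_lebesgue_cube m (ltW e0).
apply: (@le_lt_trans _ _ (tuple_lebesgue m (tuple_cube e))); last first.
  by rewrite C ltry.
apply: le_measure; rewrite ?inE//; first exact: measurable_tuple_ball.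
move=> t te i; rewrite ltW// (le_lt_trans _ te)// -sqrtr_sqr ler_wsqrtr//.
rewrite (bigD1 i)//= mxE lerDl; apply: sumr_ge0 => j _; exact: sqr_ge0.
Qed.

Lemma product_measure12E d1 d2 (T1 : measurableType d1) (T2 : measurableType d2)
    (m1 : {sigma_finite_measure set T1 -> \bar R})
    (m2 : {sigma_finite_measure set T2 -> \bar R}) X : measurable X ->
  (m1 \x m2)%E X = (m1 \x^ m2)%E X.
Proof.
by apply: product_measure_unique => A B mA mB; rewrite /= product_measure2E.
Qed.

(* Uniqueness of Haar measure: evaluate lambda x lambda in both orders on
   {(s, y) | s Q in A, y - s Q in B}; the answer is symmetric in A and B. *)
Lemma tuple_lebesgue_mulmx_swap m (Q : 'M[R]_m) (A B : set (m.-tuple T)) :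
  Q *m Q^T = 1%:M -> measurable A -> measurable B ->
  (tuple_lebesgue m (tuple_mulmx Q @^-1` A) * tuple_lebesgue m B =
   tuple_lebesgue m (tuple_mulmx Q @^-1` B) * tuple_lebesgue m A)%E.
Proof.
move=> Q1 mA mB; set L := tuple_lebesgue m.
pose g (z : m.-tuple T * m.-tuple T) : m.-tuple T :=
  tuple_of_row (row_of_tuple z.2 - row_of_tuple z.1 *m Q).
have mg : measurable_fun setT g.
  apply/measurable_fun_tnthP => i.
  rewrite (_ : _ \o _ = fun z => tnth z.2 i - tnth (tuple_mulmx Q z.1) i).
    apply: measurable_funB; apply: (measurableT_comp (measurable_tnth i)) => //.
    exact: (measurableT_comp (measurable_tuple_mulmx Q) measurable_fst).
  by apply/funext => z /=; rewrite !tnth_mktuple !mxE.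
have gE s y : g (s, y) = tuple_affine 1 (tuple_of_row (- (row_of_tuple s *m Q))) y.
  apply: eq_from_tnth => i; rewrite /g !tnth_mktuple mul1r.
  by rewrite [in LHS]mxE [in LHS]mxE.
pose E (A B : set (m.-tuple T)) : set (m.-tuple T * m.-tuple T) :=
  [set z | A (tuple_mulmx Q z.1) /\ B (g z)].
have mE A' B' : measurable A' -> measurable B' -> measurable (E A' B').
  move=> mA' mB'; apply: measurableI; last first.
    by have := mg measurableT _ mB'; rewrite setTI.
  have mQ1 : measurable_fun [set: m.-tuple T * m.-tuple T]
      (fun z => tuple_mulmx Q z.1).
    exact: (measurableT_comp (measurable_tuple_mulmx Q) measurable_fst).
  by have := mQ1 measurableT _ mA'; rewrite setTI.
(* Integrating in y first: the section at s is a translate of B' or empty, so translation invariance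
   gives a product. *)
have E1 A' B' : measurable A' -> measurable B' ->
    (L \x L)%E (E A' B') = (L (tuple_mulmx Q @^-1` A') * L B')%E.
  move=> mA' mB'; have mQ : measurable (tuple_mulmx Q @^-1` A').
    by have := @measurable_tuple_mulmx m Q measurableT _ mA'; rewrite setTI.
  rewrite /product_measure1.
  rewrite (eq_integral (fun s => (\1_(tuple_mulmx Q @^-1` A') s)%:E * L B')%E).
    by rewrite ge0_integralZr ?integral_indic ?setIT//; exact: measurableT_comp.
  move=> s _ /=; rewrite indicE.
  have [sA|sA] := boolP (s \in tuple_mulmx Q @^-1` A').
    rewrite mul1e -[RHS](@tuple_lebesgue_affine R m 1
      (tuple_of_row (- (row_of_tuple s *m Q))))// ?expr1n//.
    rewrite inE in sA; congr (L _); apply/seteqP; split => y.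
      by move=> /xsectionP[_]; rewrite gE.
    by move=> yB; apply/xsectionP; split => //; rewrite gE.
  rewrite mul0e (_ : xsection _ _ = set0) ?measure0//.
  apply/seteqP; split => // y /xsectionP[sA' _].
  by move: sA; rewrite notin_setE; apply.
rewrite -E1// -E1// product_measure12E ?product_measure12E; try exact: mE.
apply: eq_integral => y _ /=.
have mEy : measurable (ysection (E B A) y).
  by apply: measurable_ysection; apply: mE.
(* For fixed y, the reflection s -> y Q^T - s exchanges s Q and y - s Q, hence the two conditions
   that define the section. *)
rewrite -[RHS](@tuple_lebesgue_affine R m (-1) (tuple_mulmx Q^T y))//; last first.
  by rewrite sqrrN expr1n.
have sE s : tuple_mulmx Q (tuple_affine (-1) (tuple_mulmx Q^T y) s) = g (s, y).
  rewrite /tuple_mulmx /g; congr tuple_of_row => /=.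
  rewrite (_ : row_of_tuple (tuple_affine _ _ _) =
    row_of_tuple y *m Q^T - row_of_tuple s).
    by rewrite mulmxBl -mulmxA (mulmx1C Q1) mulmx1.
  by apply/rowP => i; rewrite mxE tnth_mktuple tnth_mktuple !mxE mulN1r addrC.
have gK s : g (tuple_affine (-1) (tuple_mulmx Q^T y) s, y) = tuple_mulmx Q s.
  rewrite /g /=; congr tuple_of_row.
  rewrite -[X in _ - X]tuple_of_rowK -/(tuple_mulmx Q _) sE /g tuple_of_rowK.
  by rewrite opprB addrCA subrr addr0.
congr (L _); apply/seteqP; split => s.
  by move=> /ysectionP[? ?]; apply/ysectionP; split; rewrite /= ?sE ?gK.
by move=> /ysectionP[]; rewrite /= sE gK => ? ?; apply/ysectionP; split.
Qed.

(** In the swap identity take for B the unit ball: it is invariant under Q, and its measure is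
    positive and finite, so it cancels. *)
Lemma tuple_lebesgue_mulmx m (Q : 'M[R]_m) (A : set (m.-tuple T)) :
  Q *m Q^T = 1%:M -> measurable A ->
  tuple_lebesgue m (tuple_mulmx Q @^-1` A) = tuple_lebesgue m A.
Proof.
move=> Q1 mA; have mB := @measurable_tuple_ball m 1.
have := tuple_lebesgue_mulmx_swap Q1 mA mB.
rewrite (_ : tuple_mulmx Q @^-1` tuple_ball 1 = tuple_ball 1); last first.
  apply/funext => t; rewrite /preimage/= /tuple_ball/= tuple_of_rowK.
  by rewrite enorm_mulmx.
have /andP[B0 Boo] := @tuple_lebesgue_ball m 1 ltr01.
have Bfin : tuple_lebesgue m (tuple_ball 1) \is a fin_num.
  by rewrite ge0_fin_numE// ltW.
rewrite [RHS]muleC => H; apply/eqP; rewrite eq_le.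
by apply/andP; split; rewrite -(lee_pmul2r Bfin B0) H.
Qed.

Local Open Scope measure_scope.

(** A measurable cover of A pulls back to a measurable cover of the preimage with the same total
    measure. Applied to Q and to Q^T this gives equality. *)
Lemma tuple_outer_mulmx_le m (Q : 'M[R]_m) (A : set (m.-tuple T)) :
  Q *m Q^T = 1%:M ->
  ((tuple_lebesgue m)^* (tuple_mulmx Q @^-1` A) <= (tuple_lebesgue m)^* A)%E.
Proof.
move=> Q1; apply: le_ereal_inf_tmp => _ [F [mF AF] <-].
apply: ereal_inf_lbound; exists (fun k => tuple_mulmx Q @^-1` F k).
  split=> [k|t /AF [k _ Fk]]; last by exists k.
  by have := @measurable_tuple_mulmx m Q measurableT _ (mF k); rewrite setTI.
by apply: eq_eseriesr => k _; rewrite tuple_lebesgue_mulmx.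
Qed.

Lemma tuple_outer_mulmx m (Q : 'M[R]_m) (A : set (m.-tuple T)) :
  Q *m Q^T = 1%:M ->
  (tuple_lebesgue m)^* (tuple_mulmx Q @^-1` A) = (tuple_lebesgue m)^* A.
Proof.
move=> Q1; apply/eqP; rewrite eq_le tuple_outer_mulmx_le//=.
have Q1' : Q^T *m Q^T^T = 1%:M by rewrite trmxK (mulmx1C Q1).
rewrite -[in leLHS](_ : tuple_mulmx Q^T @^-1` (tuple_mulmx Q @^-1` A) = A).
  exact: tuple_outer_mulmx_le.
apply/funext => t; rewrite /preimage /=; congr A.
by have := tuple_mulmxK Q1' t; rewrite trmxK.
Qed.

End orthogonal_invariance.

(** * Orthonormal frames and means over hyperplane balls *)

Section frames.
Context {R : realType} {m : nat}.
Implicit Types (nu a b : 'rV[R]_m.+1) (P Q : 'M[R]_(m, m.+1)).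

(** The property under the choice in [frame], named so that frames other than the chosen one can be
    used. *)
Definition is_frame nu Q := Q *m Q^T = 1%:M /\ Q *m nu^T = 0.

Lemma is_frameN nu Q : is_frame nu Q -> is_frame (- nu) Q.
Proof. by move=> [QQ Qnu]; split=> //; rewrite raddfN/= mulmxN Qnu oppr0. Qed.

Lemma is_frameZ c nu Q : is_frame nu Q -> is_frame (c *: nu) Q.
Proof.
by move=> [QQ Qnu]; split=> //; rewrite linearZ/= -scalemxAr Qnu scaler0.
Qed.

Lemma is_frame_opp nu Q : is_frame nu Q -> is_frame nu (- Q).
Proof.
move=> [QQ Qnu]; split; last by rewrite mulNmx Qnu oppr0.
by rewrite raddfN/= mulNmx mulmxN opprK.
Qed.

Lemma is_frame_dotp nu Q (y : 'rV[R]_m) : is_frame nu Q ->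
  dotp (y *m Q) nu = 0.
Proof. by move=> [_ Q0]; rewrite dotpE -mulmxA Q0 mulmx0 mxE. Qed.

(* The rotation of the plane spanned by a and b that sends a to b. *)
Definition rotate_frame a b P : 'M[R]_(m, m.+1) :=
  P - (1 + dotp a b)^-1 *: (P *m b^T *m (a + b)).

(** Let s = 1 + a.b and w = P b^T. Orthogonality to b holds because (a + b).b = s. In the product
    with the transpose, the two cross terms give -(2 / s) w w^T, and the quadratic term gives the
    opposite since |a + b|^2 = 2 s. *)
Lemma rotate_frameP a b P : enorm a = 1 -> enorm b = 1 -> 1 + dotp a b != 0 ->
  is_frame a P -> is_frame b (rotate_frame a b P).
Proof.
move=> a1 b1 ab0 [PP Pa].
have mx11 (x y : 'rV[R]_m.+1) : x *m y^T = (dotp x y)%:M :> 'M[R]_1.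
  by rewrite dotpE -mx11_scalar.
have bb : dotp b b = 1 by rewrite -sqr_enorm b1 expr1n.
have aa : dotp a a = 1 by rewrite -sqr_enorm a1 expr1n.
set s := 1 + dotp a b in ab0.
split; last first.
  rewrite mulmxBl -scalemxAl -[P *m _ *m _ *m _]mulmxA mx11 dotpDl bb (addrC _ 1) -/s.
  by rewrite mul_mx_scalar scalerA mulVf// scale1r subrr.
rewrite /rotate_frame -/s raddfB/= mulmxBl !mulmxBr PP.
rewrite !linearZ/= -?scalemxAl -?scalemxAr.
have H1 : P *m (P *m b^T *m (a + b))^T = P *m b^T *m (P *m b^T)^T.
  by rewrite trmx_mul mulmxA raddfD/= mulmxDr Pa add0r.
have H2 : P *m b^T *m (a + b) *m P^T = P *m b^T *m (P *m b^T)^T.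
  rewrite -mulmxA; congr (_ *m _); rewrite trmx_mul trmxK mulmxDl.
  by rewrite -[a *m _]trmxK trmx_mul trmxK Pa trmx0 add0r.
have H3 : P *m b^T *m (a + b) *m (P *m b^T *m (a + b))^T =
    (2 * s) *: (P *m b^T *m (P *m b^T)^T).
  rewrite [in X in _ *m X]trmx_mul mulmxA -[_ *m (a + b) *m _]mulmxA mx11.
  rewrite dotpDl !dotpDr aa bb (dotpC b a) mul_mx_scalar -scalemxAl.
  by congr (_ *: _); rewrite /s; ring.
rewrite H1 H2 H3 !scalerN opprB !scalerA.
rewrite (_ : s^-1 * s^-1 * (2 * s) = s^-1 + s^-1); last by field.
by rewrite scalerDl addrK subrK.
Qed.

Lemma mulmx_rotate_frame a b P (y : 'rV[R]_m) :
  y *m rotate_frame a b P =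
  y *m P - ((1 + dotp a b)^-1 * dotp (y *m P) b) *: (a + b).
Proof.
rewrite mulmxBr -scalemxAr !mulmxA [y *m P *m _]mx11_scalar mul_scalar_mx.
by rewrite scalerA -dotpE.
Qed.

Lemma exists_unit_frame b : enorm b = 1 -> exists Q, is_frame b Q.
Proof.
move=> b1; pose a : 'rV[R]_m.+1 := delta_mx 0 0.
pose P : 'M[R]_(m, m.+1) := \matrix_(i, j) (j == lift ord0 i)%:R.
have Pa : is_frame a P.
  split; apply/matrixP => i j; rewrite !mxE.
    rewrite (bigD1 (lift ord0 i))//= big1 => [|k /negPf kE]; rewrite !mxE.
      by rewrite eqxx mul1r addr0 (inj_eq lift_inj).
    by rewrite kE mul0r.
  rewrite big1// => k _; rewrite !mxE.
  have [->|] := eqVneq k (lift ord0 i); last by rewrite mul0r.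
  by rewrite andbF mulr0.
have a1 : enorm a = 1 by exact: enorm_delta.
(* The rotation formula breaks down for b = - a; then P is also a frame for - a, and the denominator
   becomes 2. *)
have [ab|ab] := eqVneq (1 + dotp a b) 0.
  exists (rotate_frame (- a) b P); apply: rotate_frameP => //.
  - by rewrite enormN.
  - by rewrite dotpNl; have -> : dotp a b = -1 by lra.
  - exact: is_frameN.
by exists (rotate_frame a b P); exact: rotate_frameP.
Qed.

(** Frames exist for nonzero directions, so the choice in [frame] does not fall back on its default
    value 0. *)
Lemma frameP nu : nu != 0 -> is_frame nu (frame nu).
Proof.
move=> nu0; have nu1 : enorm nu != 0 by rewrite enorm_eq0.
rewrite /frame; set S := [set Q | _].
suff [Q SQ] : exists Q, S Q by exact: (xgetPex 0 (ex_intro _ Q SQ)).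
have [|Q Qb] := @exists_unit_frame ((enorm nu)^-1 *: nu).
  by rewrite enormZ ger0_norm ?invr_ge0 ?enorm_ge0// mulVf.
exists Q; have := is_frameZ (enorm nu) Qb.
by rewrite scalerA mulfV// scale1r.
Qed.

(** The unit normal stacked on P is a square matrix G with G G^T = 1, hence also G^T G = 1. So P^T P
    is the orthogonal projection onto the hyperplane. *)
Lemma frame_span nu P : nu != 0 -> is_frame nu P ->
  P^T *m P = 1%:M - (enorm nu ^+ 2)^-1 *: (nu^T *m nu).
Proof.
move=> nu0 [PP Pnu]; have nu1 : enorm nu != 0 by rewrite enorm_eq0.
pose b := (enorm nu)^-1 *: nu.
pose G : 'M[R]_(1 + m) := col_mx b P.
have G1 : G *m G^T = 1%:M.
  rewrite /G tr_col_mx mul_col_row PP [RHS]scalar_mx_block.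
  have bP : P *m b^T = 0 by rewrite /b linearZ/= -scalemxAr Pnu scaler0.
  have Pb : b *m P^T = 0 by rewrite -[LHS]trmxK trmx_mul trmxK bP trmx0.
  have bb : b *m b^T = 1%:M.
    rewrite [LHS]mx11_scalar -dotpE -sqr_enorm enormZ.
    by rewrite ger0_norm ?invr_ge0 ?enorm_ge0// mulVf// expr1n.
  by rewrite bP Pb bb.
have := mulmx1C G1; rewrite /G tr_col_mx mul_row_col => H.
have bb : b^T *m b = (enorm nu ^+ 2)^-1 *: (nu^T *m nu).
  by rewrite /b !linearZ/= -?scalemxAl -?scalemxAr scalerA -exprVn expr2.
have <- : b^T *m b + P^T *m P = 1%:M := H.
by rewrite bb addrAC subrr add0r.
Qed.

(** The rows of Q lie in the hyperplane onto which P^T P projects, so Q = (Q P^T) P. *)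
Lemma frame_change nu P Q : nu != 0 -> is_frame nu P -> is_frame nu Q ->
  exists2 O : 'M[R]_m, O *m O^T = 1%:M & Q = O *m P.
Proof.
move=> nu0 fP [QQ Qnu]; have [PP Pnu] := fP.
have QPP : Q *m P^T *m P = Q.
  rewrite -mulmxA (frame_span nu0 fP) mulmxBr mulmx1.
  by rewrite -scalemxAr mulmxA Qnu mul0mx scaler0 subr0.
exists (Q *m P^T); last by rewrite QPP.
by rewrite trmx_mul trmxK mulmxA QPP.
Qed.

End frames.

(** * Change of variables for image measures *)

Section transfer.
Context d1 d2 (X : measurableType d1) (Y : measurableType d2) {R : realType}.
Variables (phi : X -> Y) (mphi : measurable_fun [set: X] phi).
Variables (mu : {measure set X -> \bar R}) (nu : {measure set Y -> \bar R}).
Hypothesis nuE : forall A, measurable A -> nu A = mu (phi @^-1` A).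
Local Open Scope ereal_scope.

Lemma ge0_integral_transfer D (f : Y -> \bar R) : measurable D ->
  measurable_fun D f -> {in D, forall y, 0 <= f y} ->
  \int[nu]_(y in D) f y = \int[mu]_(x in phi @^-1` D) (f \o phi) x.
Proof.
move=> mD mf f0; rewrite -(ge0_integral_pushforward mphi)//.
by apply: eq_measure_integral => A mA _; exact: nuE.
Qed.

Lemma integral_transfer D (f : Y -> \bar R) : measurable D ->
  nu.-integrable D f ->
  mu.-integrable (phi @^-1` D) (f \o phi) /\
  \int[nu]_(y in D) f y = \int[mu]_(x in phi @^-1` D) (f \o phi) x.
Proof.
move=> mD /integrableP[mf foo]; split.
  apply/integrableP; split.
    apply: (measurable_comp mD) => //; last exact: measurable_funTS.
    by move=> _ [x Dx <-].
  move: foo; rewrite ge0_integral_transfer//.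
  by apply: measurableT_comp.
rewrite integralE [RHS]integralE [in RHS]funepos_comp [in RHS]funeneg_comp.
congr (_ - _).
  apply: ge0_integral_transfer => //; first exact: measurable_funepos.
apply: ge0_integral_transfer => //; exact: measurable_funeneg.
Qed.

End transfer.

(** * Means over hyperplane balls, computed in an arbitrary frame *)

Section hyperplane_mean.
Context {R : realType} {m : nat}.
Local Notation T := (measurableTypeR R).
Implicit Types (u : 'rV[R]_m.+1 -> R) (x z nu : 'rV[R]_m.+1).
Implicit Types (P Q : 'M[R]_(m, m.+1)) (eps c : R).

Let mu : {outer_measure set (m.-tuple T) -> \bar R} := ((tuple_lebesgue m)^*)%mu.

(** The completed Lebesgue measure of R^m: the hyperplane measures live on Caratheodory sets, and
    these pull back to Caratheodory sets. *)
Let L : {measure set (caratheodory_type mu) -> \bar R} :=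
  (mu : set (caratheodory_type mu) -> \bar R).

Definition frame_map Q (t : m.-tuple T) : 'rV[R]_m.+1 := row_of_tuple t *m Q.

Lemma frame_map_inj nu Q : is_frame nu Q -> injective (frame_map Q).
Proof.
move=> [QQ _] s t /(congr1 (fun y => y *m Q^T)).
rewrite /frame_map -!mulmxA QQ !mulmx1.
exact: (can_inj (@row_of_tupleK R m)).
Qed.

(** Two frames of a hyperplane differ by an orthogonal matrix, which preserves the outer measure:
    this is where rotation invariance enters. *)
Lemma hyperplane_outer_frame nu Q A : nu != 0 -> is_frame nu Q ->
  hyperplane_outer nu A = mu (frame_map Q @^-1` A).
Proof.
move=> nu0 fQ; have [U U1 QE] := frame_change nu0 (frameP nu0) fQ.
transitivity (mu (frame_map (frame nu) @^-1` A)); first by [].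
rewrite -[LHS](tuple_outer_mulmx _ U1); congr (mu _).
apply/funext => t; rewrite /preimage/=; congr A.
by rewrite /frame_map /tuple_mulmx tuple_of_rowK QE mulmxA.
Qed.

(** The Caratheodory criterion for the preimage, tested on Y, is the criterion for A tested on the
    image of Y; injectivity of the frame map recovers Y from its image. *)
Lemma measurable_frame_map nu Q : nu != 0 -> is_frame nu Q ->
  measurable_fun [set: caratheodory_type mu]
    (frame_map Q : caratheodory_type mu -> caratheodory_type (hyperplane_outer nu)).
Proof.
move=> nu0 fQ _ A mA; rewrite setTI.
suff : mu.-caratheodory (frame_map Q @^-1` A) by [].
have {}mA : (hyperplane_outer nu).-caratheodory A := mA.
move=> Y; have := mA (frame_map Q @` Y).
rewrite !(hyperplane_outer_frame _ nu0 fQ) !preimage_setI preimage_setC.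
rewrite (_ : frame_map Q @^-1` (frame_map Q @` Y) = Y) //.
apply/seteqP; split=> [t [s Ys /(frame_map_inj fQ) <-]//|t Yt]; by exists t.
Qed.

Lemma preimage_hyperplane_ball nu Q eps : is_frame nu Q ->
  frame_map Q @^-1` hyperplane_ball eps nu = tuple_ball eps.
Proof.
move=> fQ; have [QQ _] := fQ; apply/seteqP; split => t.
  by move=> [+ _]; rewrite /frame_map enorm_mulmx.
move=> te; split; first by rewrite /frame_map enorm_mulmx.
exact: is_frame_dotp fQ.
Qed.

Lemma measurable_cara_ball eps :
  measurable (tuple_ball eps : set (caratheodory_type mu)).
Proof.
apply: sub_caratheodory; apply: sub_sigma_algebra.
exact: measurable_tuple_ball.
Qed.

Lemma measurable_hyperplane_ball nu eps : nu != 0 ->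
  measurable (hyperplane_ball eps nu : set (caratheodory_type (hyperplane_outer nu))).
Proof.
move=> nu0; have fQ := frameP nu0.
have pB := preimage_hyperplane_ball eps fQ.
have mB : mu.-caratheodory (tuple_ball eps) := measurable_cara_ball eps.
suff : (hyperplane_outer nu).-caratheodory (hyperplane_ball eps nu) by [].
move: (hyperplane_ball eps nu) pB => B pB Y.
rewrite !(hyperplane_outer_frame _ nu0 fQ) !preimage_setI -preimage_setC pB.
exact: mB.
Qed.

Definition hyperplane_mean eps u x nu : R :=
  (fine (hyperplane_lebesgue nu (hyperplane_ball eps nu)))^-1 *
  \int[hyperplane_lebesgue nu]_(h in hyperplane_ball eps nu) u (x + h).

Definition ball_mean eps (g : m.-tuple T -> R) : R :=
  (fine (L (tuple_ball eps)))^-1 * \int[L]_(t in tuple_ball eps) g t.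

Lemma ball_volume eps : 0 < eps ->
  0 < fine (L (tuple_ball eps)) /\ (L (tuple_ball eps) < +oo)%E.
Proof.
move=> e0.
have -> : L (tuple_ball eps) = tuple_lebesgue m (tuple_ball eps).
  by apply: measurable_mu_extE; exact: measurable_tuple_ball.
have /andP[B0 Boo] := @tuple_lebesgue_ball R m eps e0.
by split=> //; rewrite fine_gt0// B0.
Qed.

(** The freedom in Q is what makes couplings possible: coupling two noises amounts to choosing two
    frames. *)
Lemma hyperplane_meanE eps u x nu Q : nu != 0 -> is_frame nu Q ->
  W_well_defined eps u x nu ->
  L.-integrable (tuple_ball eps) (fun t => (u (x + frame_map Q t))%:E) /\
  hyperplane_mean eps u x nu = ball_mean eps (fun t => u (x + frame_map Q t)).
Proof.
move=> nu0 fQ iu.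
have nuE A : measurable A -> hyperplane_lebesgue nu A = L (frame_map Q @^-1` A).
  by move=> _; exact: hyperplane_outer_frame.
have mB := measurable_hyperplane_ball eps nu0.
have [iu' iuE] := integral_transfer (measurable_frame_map nu0 fQ) nuE mB iu.
rewrite (preimage_hyperplane_ball _ fQ) in iu' iuE.
split=> //; rewrite /hyperplane_mean /ball_mean /Rintegral iuE nuE//.
by rewrite (preimage_hyperplane_ball _ fQ).
Qed.

Lemma integrable_ball_cst eps c : 0 < eps ->
  L.-integrable (tuple_ball eps) (EFin \o cst c).
Proof.
move=> e0; have mB := measurable_cara_ball eps.
have mc : measurable_fun (tuple_ball eps : set (caratheodory_type mu))
    (cst c : caratheodory_type mu -> R) by exact: measurable_cst.
apply/integrableP; split; first exact/measurable_EFinP.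
rewrite (eq_integral (cst `|c|%:E))// integral_cst//.
by rewrite lte_mul_pinfty// ?lee_fin// (ball_volume e0).2.
Qed.

Lemma ball_mean_le eps g c : 0 < eps ->
  L.-integrable (tuple_ball eps) (EFin \o g) ->
  (forall t, tuple_ball eps t -> g t <= c) -> ball_mean eps g <= c.
Proof.
move=> e0 ig gc; have [V0 Voo] := ball_volume e0.
have mB := measurable_cara_ball eps.
have iC : L.-integrable (tuple_ball eps) (EFin \o cst c).
  exact: integrable_ball_cst.
rewrite /ball_mean mulrC ler_pdivrMr//.
by rewrite -(Rintegral_cst L mB); apply: le_Rintegral.
Qed.

Lemma ball_meanD eps f g :
  L.-integrable (tuple_ball eps) (EFin \o f) ->
  L.-integrable (tuple_ball eps) (EFin \o g) ->
  ball_mean eps (f \+ g) = ball_mean eps f + ball_mean eps g.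
Proof.
move=> fi gi; rewrite /ball_mean RintegralD// ?mulrDr//.
exact: measurable_cara_ball.
Qed.

Lemma ball_meanB eps f g :
  L.-integrable (tuple_ball eps) (EFin \o f) ->
  L.-integrable (tuple_ball eps) (EFin \o g) ->
  ball_mean eps (f \- g) = ball_mean eps f - ball_mean eps g.
Proof.
move=> fi gi; rewrite /ball_mean RintegralB// ?mulrBr//.
exact: measurable_cara_ball.
Qed.

(* The reflected frame -Q spans the same hyperplane, so the mean may be
   symmetrized. *)
Lemma hyperplane_mean_sym eps u x nu Q : nu != 0 -> is_frame nu Q ->
  W_well_defined eps u x nu ->
  L.-integrable (tuple_ball eps)
    (fun t => (u (x + frame_map Q t) + u (x - frame_map Q t))%:E) /\
  hyperplane_mean eps u x nu *+ 2 =
  ball_mean eps (fun t => u (x + frame_map Q t) + u (x - frame_map Q t)).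
Proof.
move=> nu0 fQ iu; have mB := measurable_cara_ball eps.
have [i1 E1] := hyperplane_meanE nu0 fQ iu.
have [i2 E2] := hyperplane_meanE nu0 (is_frame_opp fQ) iu.
have H : (fun t => u (x + frame_map (- Q) t)) = (fun t => u (x - frame_map Q t)).
  by apply/funext => t; rewrite /frame_map mulmxN.
rewrite H in E2.
have {}i2 : L.-integrable (tuple_ball eps) (EFin \o (fun t => u (x - frame_map Q t))).
  by rewrite -H.
split; first exact: (integrableD mB i1 i2).
by rewrite mulr2n {1}E1 E2 -ball_meanD.
Qed.

(** The coupling of two noises: one y in R^m moves x through P and z through Q. Pairing y with - y
    removes first order terms from the bound to be checked. *)
Lemma hyperplane_mean_diff_le eps u x z nu nu' P Q c :
  0 < eps -> nu != 0 -> nu' != 0 -> is_frame nu P -> is_frame nu' Q ->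
  W_well_defined eps u x nu -> W_well_defined eps u z nu' ->
  (forall y : 'rV[R]_m, enorm y < eps ->
    (u (x + y *m P) - u (z + y *m Q)) + (u (x - y *m P) - u (z - y *m Q))
      <= c *+ 2) ->
  hyperplane_mean eps u x nu - hyperplane_mean eps u z nu' <= c.
Proof.
move=> e0 nu0 nu0' fP fQ iu iu' H; rewrite -(ler_pMn2r (isT : (0 < 2)%N)) mulrnBl.
have [i1 ->] := hyperplane_mean_sym nu0 fP iu.
have [i2 ->] := hyperplane_mean_sym nu0' fQ iu'.
rewrite -ball_meanB//; apply: ball_mean_le => //.
  exact: (integrableB (measurable_cara_ball eps) i1 i2).
by move=> t te; rewrite (le_trans _ (H _ te))// /frame_map/=; lra.
Qed.

Lemma hyperplane_mean_le eps u x nu P c :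
  0 < eps -> nu != 0 -> is_frame nu P -> W_well_defined eps u x nu ->
  (forall y : 'rV[R]_m, enorm y < eps ->
    u (x + y *m P) + u (x - y *m P) <= c *+ 2) ->
  hyperplane_mean eps u x nu <= c.
Proof.
move=> e0 nu0 fP iu H; rewrite -(ler_pMn2r (isT : (0 < 2)%N)).
have [i1 ->] := hyperplane_mean_sym nu0 fP iu.
by apply: ball_mean_le => // t te; exact: H.
Qed.

Lemma hyperplane_mean_ge eps u x nu P c :
  0 < eps -> nu != 0 -> is_frame nu P -> W_well_defined eps u x nu ->
  (forall y : 'rV[R]_m, enorm y < eps ->
    c *+ 2 <= u (x + y *m P) + u (x - y *m P)) ->
  c <= hyperplane_mean eps u x nu.
Proof.
move=> e0 nu0 fP iu H; rewrite -(ler_pMn2r (isT : (0 < 2)%N)).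
have [i1 ->] := hyperplane_mean_sym nu0 fP iu.
have mB := measurable_cara_ball eps; have [V0 Voo] := ball_volume e0.
rewrite /ball_mean mulrC ler_pdivlMr//.
rewrite -(Rintegral_cst L mB); apply: le_Rintegral => //.
  exact: integrable_ball_cst.
by move=> t te; exact: H.
Qed.

End hyperplane_mean.

(** * Powers of the Euclidean norm *)

Section power_inequalities.
Context {R : realType}.
Implicit Types (a s v x y t : R).

Lemma is_derive_ge0_le (f df : R -> R) a b : a <= b ->
  (forall x, a <= x <= b -> is_derive x 1 f (df x)) ->
  (forall x, a <= x <= b -> 0 <= df x) -> f a <= f b.
Proof.
move=> ab fd df0.
have cf : {within `[a, b], continuous f}.
  apply: derivable_within_continuous => x; rewrite in_itv/= => xab.
  by have [] := fd x xab.
have [|c cab] := @MVT_segment _ f df a b ab _ cf.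
  by move=> x; rewrite in_itv/= => /andP[? ?]; apply: fd; rewrite !ltW.
rewrite -subr_ge0 => ->; rewrite mulr_ge0 ?subr_ge0//.
by apply: df0; move: cab; rewrite in_itv.
Qed.

(** Convexity of exp. With y = ln (1 + s), the tangent of exp at a y is evaluated at y ([H1]) and at
    0 ([H2]); the combination with weights a and 1 - a is the claim. *)
Lemma powR_Bernoulli a s : 0 <= a <= 1 -> -1 <= s ->
  (1 + s) `^ a <= 1 + a * s.
Proof.
move=> /andP[a0 a1]; rewrite le_eqVlt => /orP[/eqP<-|s1].
  (* At s = -1 the base is 0, and its power is 1 for a = 0 but 0 otherwise. *)
  rewrite subrr; have [->|a0'] := eqVneq a 0; first by rewrite powRr0; lra.
  by rewrite powR0//; lra.
have s0 : 0 < 1 + s by lra.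
rewrite /powR gt_eqF//; set y := ln (1 + s).
have -> : s = expR y - 1 by rewrite lnK ?posrE//; lra.
have H1 : expR (a * y) * (1 + (1 - a) * y) <= expR y.
  rewrite [leRHS](_ : _ = expR (a * y) * expR ((1 - a) * y)).
    by rewrite ler_pM2l ?expR_gt0// expR_ge1Dx.
  by rewrite -expRD; congr expR; ring.
have H2 : expR (a * y) * (1 - a * y) <= 1.
  rewrite -[leRHS]expR0 [in leRHS](_ : 0 = a * y + - (a * y)); last by ring.
  by rewrite expRD ler_pM2l ?expR_gt0// -mulNr expR_ge1Dx.
by move: (expR (a * y)) (expR y) H1 H2 => A B; nra.
Qed.

Lemma powR_Bernoulli_neg c s : 0 <= c -> -1 < s -> 1 - c * s <= (1 + s) `^ (- c).
Proof.
move=> c0 s1; rewrite /powR gt_eqF; last by lra.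
apply: le_trans (expR_ge1Dx _); rewrite mulNr lerD2l lerN2 ler_wpM2l//.
exact: le_ln1Dx.
Qed.

Lemma is_derive_powR_affine c k x : 0 < 1 + k * x ->
  is_derive x 1 (fun x : R => (1 + k * x) `^ c) (c * k * (1 + k * x) `^ (c - 1)).
Proof.
move=> x0; have d1 := @is_derive1_powR R c (1 + k * x) x0.
have d2 : is_derive x 1 (fun x : R => 1 + k * x) k.
  rewrite (_ : (fun _ => _) = cst 1 + k *: (@id R)); last exact/funext.
  have dk := @is_deriveZ _ _ _ (@id R) k x 1 1 (is_derive_id x 1).
  apply: is_derive_eq (is_deriveD (is_derive_cst (1 : R) x 1) dk) _.
  by rewrite add0r /GRing.scale/= mulr1.
apply: is_derive_eq (@is_derive1_comp R ((@powR R)^~ c)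
  (fun x => 1 + k * x) x _ _ d1 d2) _.
by rewrite -!mulrA [_ * k]mulrC.
Qed.

(** The derivative of the difference is b times (1 - x)^(-b-1) + (1 + x)^(-b-1). This sum is at
    least 2, since the linear terms of the two Bernoulli bounds cancel. *)
Lemma powR_neg_diff b v : 0 <= b -> 0 <= v < 1 ->
  2 * b * v <= (1 - v) `^ (- b) - (1 + v) `^ (- b).
Proof.
move=> b0 /andP[v0 v1].
pose f x : R := (1 + -1 * x) `^ (- b) - (1 + 1 * x) `^ (- b) - (2 * b) * x.
pose df x : R := (- b) * -1 * (1 + -1 * x) `^ (- b - 1) -
  (- b) * 1 * (1 + 1 * x) `^ (- b - 1) - (2 * b) *: (1 : R).
suff : f 0 <= f v by rewrite /f !mulr0 !addr0 !powR1 mulN1r mul1r; lra.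
apply: (@is_derive_ge0_le f df) => // x /andP[x0 xv].
  have d1 := @is_derive_powR_affine (- b) (-1) x ltac:(lra).
  have d2 := @is_derive_powR_affine (- b) 1 x ltac:(lra).
  rewrite (_ : f = (fun x : R => (1 + -1 * x) `^ (- b)) -
    (fun x : R => (1 + 1 * x) `^ (- b)) - (2 * b) *: (@id R)); last exact/funext.
  exact: is_derive_eq.
have := @powR_Bernoulli_neg (b + 1) (1 * x).
have := @powR_Bernoulli_neg (b + 1) (-1 * x).
rewrite /df opprD /GRing.scale/= => H1 H2.
have {}H1 := H1 ltac:(lra) ltac:(lra); have {}H2 := H2 ltac:(lra) ltac:(lra).
have := mulr_ge0 b0 (_ : 0 <= (1 + -1 * x) `^ (- b - 1) + (1 + 1 * x) `^ (- b - 1) - 2).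
by move=> /(_ ltac:(lra)); lra.
Qed.

(** A quantitative form of the concavity of the power a. The derivative of right side minus left
    side is a times the quantity controlled by [powR_neg_diff] with b = 1 - a. *)
Lemma powR_sym_le a v : 0 <= a <= 1 -> `|v| < 1 ->
  (1 + v) `^ a + (1 - v) `^ a <= 2 - a * (1 - a) * v ^+ 2.
Proof.
wlog v0 : v / 0 <= v => [H a01 v1|].
  have [v0|v0] := leP 0 v; first exact: H.
  have := H (- v); rewrite oppr_ge0 ltW// normrN sqrrN opprK addrC.
  exact.
move=> /andP[a0 a1]; rewrite ger0_norm// => v1.
pose f x : R := - (1 + 1 * x) `^ a - (1 + -1 * x) `^ a - (a * (1 - a)) * x ^+ 2.
pose df x : R := - (a * 1 * (1 + 1 * x) `^ (a - 1)) -
  a * -1 * (1 + -1 * x) `^ (a - 1) - (a * (1 - a)) *: (x ^+ 1 *+ 2 *: (1 : R)).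
suff : f 0 <= f v by rewrite /f !mulr0 !addr0 !powR1 expr0n/= mulN1r mul1r; lra.
apply: (@is_derive_ge0_le f df) => // x /andP[x0 xv].
  have d1 := @is_derive_powR_affine a 1 x ltac:(lra).
  have d2 := @is_derive_powR_affine a (-1) x ltac:(lra).
  rewrite (_ : f = - (fun x : R => (1 + 1 * x) `^ a) -
    (fun x : R => (1 + -1 * x) `^ a) - (a * (1 - a)) *: (@id R) ^+ 2).
    by apply: is_derive_eq; rewrite /df mulr_natl.
  by rewrite exprfctE; exact/funext.
have := @powR_neg_diff (1 - a) x; rewrite opprB => H.
have {}H := H ltac:(lra) ltac:(lra).
rewrite /df /GRing.scale/= mul1r mulN1r; nra.
Qed.

End power_inequalities.

(** * First and second order bounds for |xi + w|^g *)

Section power_of_norm.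
Context {R : realType} {n : nat}.
Implicit Types (xi w : 'rV[R]_n).

Lemma enorm_powR g xi : enorm xi `^ g = (enorm xi ^+ 2) `^ (g / 2).
Proof.
rewrite -powR_mulrn ?enorm_ge0// -powRrM; congr powR.
by field.
Qed.

Lemma sqr_powR (t g : R) : 0 <= t -> (t ^+ 2) `^ (g / 2) = t `^ g.
Proof. by move=> t0; rewrite -powR_mulrn// -powRrM; congr powR; field. Qed.

(** Bernoulli's inequality with exponent g / 2, applied to |xi + w|^2 = |xi|^2 (1 + s). *)
Lemma enorm_powR_le g xi w : 0 <= g <= 2 -> xi != 0 ->
  enorm (xi + w) `^ g <= enorm xi `^ g *
    (1 + g / 2 * (2 * dotp xi w / enorm xi ^+ 2 + enorm w ^+ 2 / enorm xi ^+ 2)).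
Proof.
move=> g02 xi0; have t0 : 0 < enorm xi by rewrite enorm_gt0.
rewrite [in leLHS]enorm_powR sqr_enormD; set t := enorm xi in t0 *.
set s := (X in _ <= _ * (1 + _ * X)).
have -> : t ^+ 2 + 2 * dotp xi w + enorm w ^+ 2 = t ^+ 2 * (1 + s).
  by rewrite /s; field; rewrite gt_eqF.
have s1 : -1 <= s.
  have : 0 <= t ^+ 2 * (1 + s).
    rewrite (_ : _ * _ = enorm (xi + w) ^+ 2) ?sqr_ge0//.
    by rewrite sqr_enormD /s -/t; field; rewrite gt_eqF.
  by rewrite pmulr_rge0 ?exprn_gt0//; lra.
rewrite powRM ?sqr_ge0//; last by lra.
rewrite (sqr_powR _ (ltW t0)) ler_wpM2l ?powR_ge0//.
by apply: powR_Bernoulli => //; lra.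
Qed.

(** Factor |xi + w|^2 and |xi - w|^2 as |xi|^2 (1 + q) (1 + v) and |xi|^2 (1 + q) (1 - v). Bernoulli
    bounds the factor in q, [powR_sym_le] the two in v; the term with coefficient 4 absorbs the
    error of order q^2. *)
Lemma enorm_powR_sym_le g xi w : 0 <= g <= 1 -> xi != 0 ->
  enorm w < enorm xi ->
  enorm (xi + w) `^ g + enorm (xi - w) `^ g <= 2 * enorm xi `^ g *
    (1 + g / 2 * (enorm w ^+ 2 / enorm xi ^+ 2
       - (2 - g) * (dotp xi w / enorm xi ^+ 2) ^+ 2
       + 4 * (enorm w ^+ 2 / enorm xi ^+ 2) ^+ 2)).
Proof.
move=> g01 xi0 wxi; have t0 : 0 < enorm xi by rewrite enorm_gt0.
rewrite ![enorm (_ + _) `^ _]enorm_powR !sqr_enormD enormN dotpNr.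
have := norm_dotp_le xi w; have := enorm_ge0 w.
set t := enorm xi in t0 wxi *; set s := enorm w in wxi *; set d := dotp xi w.
move=> s0 dle.
set q := s ^+ 2 / t ^+ 2; set k := d / t ^+ 2.
have t20 : 0 < t ^+ 2 by rewrite exprn_gt0.
have q0 : 0 <= q by rewrite divr_ge0 ?sqr_ge0.
have q1 : q < 1.
  by rewrite ltr_pdivrMr// mul1r ltr_sqr ?nnegrE// ltW.
have kq : k ^+ 2 <= q.
  rewrite /k expr_div_n ler_pdivrMr ?exprn_gt0// /q -[X in _ / X * _]mulr1.
  have -> : s ^+ 2 / (t ^+ 2 * 1) * t ^+ 2 ^+ 2 = (t * s) ^+ 2.
    by field; rewrite gt_eqF.
  by rewrite -real_normK ?num_real// ler_sqr ?nnegrE// mulr_ge0// ltW.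
have q10 : 0 < 1 + q by lra.
pose v := 2 * k / (1 + q).
have v2 : v ^+ 2 * (1 + q) ^+ 2 = 4 * k ^+ 2.
  by rewrite /v; field; rewrite gt_eqF.
(* From k^2 <= q < 1 one gets 4 k^2 <= 4 q < (1 + q)^2. *)
have vlt : `|v| < 1.
  rewrite -ltr_sqr ?nnegrE// expr1n real_normK ?num_real//.
  rewrite -(ltr_pM2r (_ : 0 < (1 + q) ^+ 2)) ?exprn_gt0// v2 mul1r.
  have : 0 < (1 - q) ^+ 2 by rewrite exprn_gt0// subr_gt0.
  nra.
have -> : t ^+ 2 + 2 * d + s ^+ 2 = t ^+ 2 * (1 + q) * (1 + v).
  by rewrite /v /k /q; field; rewrite !gt_eqF//=; nra.
have -> : t ^+ 2 + 2 * - d + s ^+ 2 = t ^+ 2 * (1 + q) * (1 - v).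
  by rewrite /v /k /q; field; rewrite !gt_eqF//=; nra.
move: vlt; rewrite ltr_norml => /andP[vl vr].
rewrite ![(t ^+ 2 * _ * _) `^ _]powRM ?mulr_ge0//; try lra.
rewrite -mulrDr powRM//; try lra.
rewrite (sqr_powR _ (ltW t0)); set a := g / 2.
have H1 := @powR_Bernoulli R a q ltac:(rewrite /a; lra) ltac:(lra).
have H2 := @powR_sym_le R a v ltac:(rewrite /a; lra) _.
rewrite ltr_norml vl vr in H2; have {}H2 := H2 isT.
rewrite -mulrA (mulrC 2) -!mulrA ler_wpM2l ?powR_ge0//.
have av : a * (1 - a) * v ^+ 2 <= 2.
  have : v ^+ 2 <= 1 by nra.
  by have := sqr_ge0 v; rewrite /a; nra.
apply: (@le_trans _ _ ((1 + a * q) * (2 - a * (1 - a) * v ^+ 2))).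
  apply: ler_pM => //; first exact: powR_ge0.
  by rewrite addr_ge0 ?powR_ge0.
have a0 : 0 <= a by rewrite /a; lra.
have a1 : a <= 1 / 2 by rewrite /a; lra.
have -> : 2 - g = 2 * (1 - a) by rewrite /a; field.
(* This is (1 + q)^-2 >= 1 - 2 q, used to return from v to the dot product k. *)
have v2' : 4 * k ^+ 2 * (1 - 2 * q) <= v ^+ 2.
  have : 0 <= v ^+ 2 * (1 - (1 + q) ^+ 2 * (1 - 2 * q)).
    rewrite mulr_ge0 ?sqr_ge0//.
    have -> : 1 - (1 + q) ^+ 2 * (1 - 2 * q) = q ^+ 2 * (3 + 2 * q) by ring.
    by rewrite mulr_ge0 ?sqr_ge0//; lra.
  by rewrite mulrBr mulr1 mulrA v2; lra.
have A0 : 0 <= a * (1 - a) by rewrite mulr_ge0//; lra.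
have H3 := ler_wpM2l A0 v2'.
have H4 : 0 <= a * (1 - a) * v ^+ 2 * (a * q).
  by rewrite (mulr_ge0 (mulr_ge0 A0 (sqr_ge0 v)) (mulr_ge0 a0 q0)).
have H5 : a * (1 - a) * (k ^+ 2 * q) <= a * (q * q).
  rewrite -mulrA ler_wpM2l//.
  have H : k ^+ 2 * q <= q * q by rewrite ler_wpM2r.
  have H' : 0 <= k ^+ 2 * q by rewrite mulr_ge0 ?sqr_ge0.
  by have := mulr_ge0 a0 H'; lra.
rewrite [g * _]mulrA -/a; move: a H3 H4 H5 {H1 H2 av a0 a1 v2' A0} => a; lra.
Qed.

End power_of_norm.

(** * Coupling two games *)

Section coupling.
Context {R : realType} {m : nat}.
Implicit Types (u : 'rV[R]_m.+1 -> R) (x z nu xi h a b v w : 'rV[R]_m.+1).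

(** [W] with the weight as a free real number; it unfolds to [W] for al = alpha p x. *)
Definition mixed_value (al eps : R) u x nu : R :=
  al * u (x + nu) + (1 - al) * hyperplane_mean eps u x nu.

(* Couple the two games: tug and tug with probability c, tug and noise with
   probability ax - c, noise and tug with probability az - c. *)
Lemma coupling_le (ax az c A B MX MZ ctt ctn cnt cnn : R) :
  0 <= c -> c <= ax -> c <= az -> ax + az - c <= 1 ->
  A - B <= ctt -> A - MZ <= ctn -> MX - B <= cnt -> MX - MZ <= cnn ->
  (ax * A + (1 - ax) * MX) - (az * B + (1 - az) * MZ) <=
  c * ctt + (ax - c) * ctn + (az - c) * cnt + (1 - (ax + az - c)) * cnn.
Proof.
move=> c0 cx cz c1 tt tn nt nn.
have cx0 : 0 <= ax - c by lra.
have cz0 : 0 <= az - c by lra.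
have c10 : 0 <= 1 - (ax + az - c) by lra.
have := ler_wpM2l c0 tt; have := ler_wpM2l cx0 tn.
have := ler_wpM2l cz0 nt; have := ler_wpM2l c10 nn.
lra.
Qed.

(** A frame for nu is one for - nu. Thus replying with the opposite direction leaves the noise
    unchanged. *)
Lemma hyperplane_meanN (eps : R) u x nu : nu != 0 ->
  W_well_defined eps u x nu -> W_well_defined eps u x (- nu) ->
  hyperplane_mean eps u x (- nu) = hyperplane_mean eps u x nu.
Proof.
move=> nu0 i1 i2; have f1 := frameP nu0; have f2 := is_frameN f1.
have nu0' : - nu != 0 by rewrite oppr_eq0.
have [_ ->] := hyperplane_meanE nu0 f1 i1.
by have [_ ->] := hyperplane_meanE nu0' f2 i2.
Qed.

(* The relative second-order change of |xi|^g under the symmetric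
   displacements w and -w, up to the factor g / 2. *)
Definition radial_bracket (g : R) xi w : R :=
  enorm w ^+ 2 / enorm xi ^+ 2 - (2 - g) * (dotp xi w / enorm xi ^+ 2) ^+ 2
  + 4 * (enorm w ^+ 2 / enorm xi ^+ 2) ^+ 2.

(** Everything is measured in units of eps / |xi|: s bounds the square length of w from above and k
    its radial part from below. The quartic term gives 64 / N^2 because s <= 4 and eps / |xi| <= 1 /
    N. *)
Lemma radial_bracket_le g xi w (eps N s k : R) :
  0 <= g <= 1 -> 0 < eps -> 0 < N -> N * eps <= enorm xi -> 0 <= k -> s <= 4 ->
  enorm w ^+ 2 <= s * eps ^+ 2 -> k * (eps * enorm xi) <= `|dotp xi w| ->
  radial_bracket g xi w <=
  (eps / enorm xi) ^+ 2 * (s - (2 - g) * k ^+ 2 + 64 / N ^+ 2).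
Proof.
move=> g01 e0 N0 Nt k0 s4 ws kd.
have t0 : 0 < enorm xi by rewrite (lt_le_trans _ Nt)// mulr_gt0.
rewrite /radial_bracket; set t := enorm xi in t0 Nt kd *.
set rho := eps / t; set q := enorm w ^+ 2 / t ^+ 2; set kk := dotp xi w / t ^+ 2.
have rho0 : 0 < rho by rewrite divr_gt0.
have t20 : 0 < t ^+ 2 by rewrite exprn_gt0.
have q0 : 0 <= q by rewrite divr_ge0 ?sqr_ge0.
have qs : q <= s * rho ^+ 2.
  by rewrite /q ler_pdivrMr// /rho expr_div_n -mulrA divfK ?gt_eqF.
have rhoN : rho ^+ 2 <= 1 / N ^+ 2.
  rewrite ler_pdivlMr ?exprn_gt0// -exprMn expr_le1 ?(mulr_ge0 (ltW rho0) (ltW N0))//.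
  by rewrite /rho mulrAC ler_pdivrMr// mul1r mulrC.
have kkk : k * rho <= `|kk|.
  rewrite /kk normrM normfV (gtr0_norm t20) ler_pdivlMr// /rho.
  by rewrite (_ : k * (eps / t) * t ^+ 2 = k * (eps * t))//; field; rewrite gt_eqF.
have kk2 : (k * rho) ^+ 2 <= kk ^+ 2.
  rewrite -[leRHS]real_normK ?num_real//.
  by rewrite ler_sqr ?nnegrE// mulr_ge0// ltW.
clearbody rho q kk; have g2 : 0 <= 2 - g by lra.
have H1 := ler_wpM2l g2 kk2.
have s0 : 0 <= s.
  have := le_trans q0 qs; by rewrite pmulr_lge0// exprn_gt0.
have H2 : q ^+ 2 <= 16 * (rho ^+ 2 * (1 / N ^+ 2)).
  apply: (@le_trans _ _ ((4 * rho ^+ 2) ^+ 2)).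
    have H : q <= 4 * rho ^+ 2 by rewrite (le_trans qs)// ler_wpM2r ?sqr_ge0.
    by rewrite ler_sqr ?nnegrE ?(le_trans q0).
  by have := ler_wpM2l (sqr_ge0 rho) rhoN; lra.
lra.
Qed.

(** The cosine bound 1 - tau^2 / 2 is the one that places a within tau eps of the radial vector of
    length eps. *)
Definition almost_aligned (tau eps : R) xi a :=
  enorm a = eps /\ (1 - tau ^+ 2 / 2) * (eps * enorm xi) <= dotp xi a.

Lemma enorm_direction (eps : R) xi : 0 < eps -> xi != 0 ->
  enorm ((eps / enorm xi) *: xi) = eps.
Proof.
move=> eps0 xi0; have t0 : 0 < enorm xi by rewrite enorm_gt0.
by rewrite enormZ ger0_norm ?divr_ge0 ?(ltW eps0) ?(ltW t0)// divfK ?gt_eqF.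
Qed.

Lemma almost_aligned_dist (tau eps : R) xi a : 0 <= tau -> 0 < eps -> xi != 0 ->
  almost_aligned tau eps xi a ->
  enorm (a - (eps / enorm xi) *: xi) <= tau * eps.
Proof.
move=> tau0 eps0 xi0; have e_norm := enorm_direction eps0 xi0.
have t0 : 0 < enorm xi by rewrite enorm_gt0.
move=> [a1 ax]; rewrite -ler_sqr ?nnegrE ?enorm_ge0 ?mulr_ge0 ?(ltW eps0) ?(ltW t0)//.
rewrite sqr_enormD enormN e_norm a1 dotpNr dotpZr (dotpC a).
have : eps * ((1 - tau ^+ 2 / 2) * eps) <= eps / enorm xi * dotp xi a.
  rewrite -mulrA ler_wpM2l ?(ltW eps0)// [leRHS]mulrC ler_pdivlMr//.
  by rewrite -mulrA.
lra.
Qed.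

Lemma almost_aligned_distance (tau eps : R) xi a b : 0 <= tau -> 0 < eps ->
  xi != 0 -> almost_aligned tau eps xi a -> almost_aligned tau eps xi b ->
  enorm (a - b) <= 2 * tau * eps.
Proof.
move=> tau0 eps0 xi0; set e := (eps / enorm xi) *: xi.
move=> /(almost_aligned_dist tau0 eps0 xi0) ae /(almost_aligned_dist tau0 eps0 xi0) be.
rewrite (_ : a - b = (a - e) + (e - b)); last by rewrite addrA subrK.
by rewrite (le_trans (enormD _ _))// [enorm (e - b)]enormB; lra.
Qed.

(** Here a + b is almost radial of length 2 eps. With s = 4 and k close to 2, the main part is 4 - 4
    (2 - g) = - 4 (1 - g). *)
Lemma tug_tug_bracket (g tau eps N : R) xi a b :
  0 <= g <= 1 -> 0 <= tau <= 1 / 16 -> 0 < eps -> 0 < N ->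
  N * eps <= enorm xi ->
  almost_aligned tau eps xi a -> almost_aligned tau eps xi b ->
  radial_bracket g xi (a + b) <=
  (eps / enorm xi) ^+ 2 * (- 4 * (1 - g) + 16 * tau + 64 / N ^+ 2).
Proof.
move=> g01 /andP[tau0 tau1] eps0 N0 Nxi.
have tau2 : tau ^+ 2 <= tau by rewrite expr2 ler_piMr//; lra.
have t0 : 0 < enorm xi by rewrite (lt_le_trans _ Nxi)// mulr_gt0.
have xi0 : xi != 0 by rewrite -enorm_gt0.
move=> [a1 ax] [b1 bx].
apply: (le_trans (@radial_bracket_le g xi _ eps N 4 (2 * (1 - tau))
  _ _ _ _ _ _ _ _)) => //; try lra.
- have : enorm (a + b) <= 2 * eps by rewrite (le_trans (enormD _ _))// a1 b1; lra.
  rewrite -ler_sqr ?nnegrE ?enorm_ge0 ?mulr_ge0 ?(ltW eps0) ?(ltW t0)//; lra.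
- rewrite (le_trans _ (ler_norm _))// dotpDr.
  have et : 0 < eps * enorm xi by rewrite mulr_gt0.
  have : tau ^+ 2 * (eps * enorm xi) <= tau * (eps * enorm xi).
    by rewrite ler_wpM2r// ltW.
  have : 0 <= tau * (eps * enorm xi) by rewrite mulr_ge0// ltW.
  lra.
- rewrite ler_wpM2l ?sqr_ge0//; nra.
Qed.

(** As h is orthogonal to b, it is almost orthogonal to a and to xi. So a - h has square length
    about 2 eps^2 at most and radial part about eps, which leaves 2 - (2 - g) = g. *)
Lemma tug_noise_bracket (g tau eps N : R) xi a b h :
  0 <= g <= 1 -> 0 <= tau <= 1 / 16 -> 0 < eps -> 0 < N ->
  N * eps <= enorm xi ->
  almost_aligned tau eps xi a -> almost_aligned tau eps xi b ->
  dotp h b = 0 -> enorm h <= eps ->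
  radial_bracket g xi (a - h) <=
  (eps / enorm xi) ^+ 2 * (g + 12 * tau + 64 / N ^+ 2).
Proof.
move=> g01 /andP[tau0 tau1] eps0 N0 Nxi.
have tau2 : tau ^+ 2 <= tau by rewrite expr2 ler_piMr//; lra.
have t0 : 0 < enorm xi by rewrite (lt_le_trans _ Nxi)// mulr_gt0.
have xi0 : xi != 0 by rewrite -enorm_gt0.
set e := (eps / enorm xi) *: xi.
move=> aa bb hb he; have [a1 ax] := aa; have [b1 bx] := bb.
have H1 : `|dotp a h| <= 2 * tau * eps ^+ 2.
  rewrite (_ : dotp a h = dotp (a - b) h); last first.
    by rewrite dotpDl dotpNl (dotpC b) hb subr0.
  rewrite (le_trans (norm_dotp_le _ _))// expr2 mulrA.
  by rewrite ler_pM ?enorm_ge0// (almost_aligned_distance tau0 eps0 xi0 aa bb).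
have H2 : dotp xi h <= tau * (eps * enorm xi).
  have : dotp e h <= tau * eps ^+ 2.
    rewrite (_ : dotp e h = dotp (e - b) h); last first.
      by rewrite dotpDl dotpNl (dotpC b) hb subr0.
    rewrite (le_trans (dotp_le _ _))// expr2 mulrA.
    by rewrite ler_pM ?enorm_ge0// enormB (almost_aligned_dist tau0 eps0 xi0 bb).
  rewrite /e dotpZl mulrAC ler_pdivrMr// => H.
  by rewrite -(ler_pM2l eps0); lra.
apply: (le_trans (@radial_bracket_le g xi _ eps N (2 + 4 * tau) (1 - 2 * tau)
  _ _ _ _ _ _ _ _)) => //; try lra.
- rewrite sqr_enormD enormN dotpNr a1.
  have : enorm h ^+ 2 <= eps ^+ 2 by rewrite ler_sqr ?nnegrE ?enorm_ge0// ltW.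
  by move: H1; rewrite ler_norml => /andP[? ?]; lra.
- rewrite (le_trans _ (ler_norm _))// dotpDr dotpNr.
  have et : 0 < eps * enorm xi by rewrite mulr_gt0.
  have : tau ^+ 2 * (eps * enorm xi) <= tau * (eps * enorm xi).
    by rewrite ler_wpM2r// ltW.
  have : 0 <= tau * (eps * enorm xi) by rewrite mulr_ge0// ltW.
  lra.
- rewrite ler_wpM2l ?sqr_ge0//; nra.
Qed.

(** Keeps the denominator in [rotate_frame] at least 1. *)
Lemma almost_aligned_dotp (tau eps : R) xi a b : 0 <= tau <= 1 / 16 ->
  0 < eps -> xi != 0 ->
  almost_aligned tau eps xi a -> almost_aligned tau eps xi b ->
  1 <= 1 + dotp (eps^-1 *: a) (eps^-1 *: b).
Proof.
move=> /andP[tau0 tau1] eps0 xi0 aa bb; have [a1 _] := aa; have [b1 _] := bb.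
have tau2 : tau ^+ 2 <= tau by rewrite expr2 ler_piMr//; lra.
set a' := eps^-1 *: a; set b' := eps^-1 *: b.
have a'1 : enorm a' = 1.
  by rewrite enormZ ger0_norm ?invr_ge0 ?(ltW eps0)// a1 mulVf ?gt_eqF.
have b'1 : enorm b' = 1.
  by rewrite enormZ ger0_norm ?invr_ge0 ?(ltW eps0)// b1 mulVf ?gt_eqF.
have ab : enorm (a' - b') <= 2 * tau.
  rewrite -scalerBr enormZ ger0_norm ?invr_ge0 ?(ltW eps0)// mulrC.
  rewrite ler_pdivrMr//.
  exact: (almost_aligned_distance tau0 eps0 xi0 aa bb).
have : enorm (a' - b') ^+ 2 <= (2 * tau) ^+ 2.
  by rewrite ler_sqr ?nnegrE ?enorm_ge0 ?mulr_ge0.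
rewrite sqr_enormD enormN dotpNr a'1 b'1; nra.
Qed.

(** The rotated noise differs from the original one by a multiple of a' + b'. Since y P is
    orthogonal to a', and b' is within 2 tau of a', the difference has length at most 4 tau eps. *)
Lemma noise_noise_bracket (g tau eps N : R) xi a b P (y : 'rV[R]_m) :
  0 <= g <= 1 -> 0 <= tau <= 1 / 16 -> 0 < eps -> 0 < N ->
  N * eps <= enorm xi ->
  almost_aligned tau eps xi a -> almost_aligned tau eps xi b ->
  is_frame a P -> enorm y < eps ->
  radial_bracket g xi
    (y *m P - y *m rotate_frame (eps^-1 *: a) (eps^-1 *: b) P) <=
  (eps / enorm xi) ^+ 2 * (16 * tau + 64 / N ^+ 2).
Proof.
move=> g01 /andP[tau0 tau1] eps0 N0 Nxi.
have tau2 : tau ^+ 2 <= tau by rewrite expr2 ler_piMr//; lra.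
have t0 : 0 < enorm xi by rewrite (lt_le_trans _ Nxi)// mulr_gt0.
have xi0 : xi != 0 by rewrite -enorm_gt0.
move=> aa bb fP ye; have [a1 ax] := aa; have [b1 bx] := bb.
set a' := eps^-1 *: a; set b' := eps^-1 *: b.
have a'1 : enorm a' = 1.
  by rewrite enormZ ger0_norm ?invr_ge0 ?(ltW eps0) ?(ltW t0)// a1 mulVf ?gt_eqF.
have b'1 : enorm b' = 1.
  by rewrite enormZ ger0_norm ?invr_ge0 ?(ltW eps0) ?(ltW t0)// b1 mulVf ?gt_eqF.
have ab : enorm (a' - b') <= 2 * tau.
  rewrite -scalerBr enormZ ger0_norm ?invr_ge0 ?(ltW eps0)// mulrC.
  rewrite ler_pdivrMr//.
  exact: (almost_aligned_distance tau0 eps0 xi0 aa bb).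
have ab2 : 1 <= 1 + dotp a' b'.
  by apply: (almost_aligned_dotp _ eps0 xi0 aa bb); rewrite tau0.
have PP := fP.1.
have yP : dotp (y *m P) a' = 0 by rewrite dotpZr (is_frame_dotp _ fP) mulr0.
have nn : enorm (y *m P - y *m rotate_frame a' b' P) <= 4 * tau * eps.
  rewrite mulmx_rotate_frame opprB addrC subrK enormZ normrM.
  rewrite (ger0_norm (_ : 0 <= (1 + dotp a' b')^-1)); last by rewrite invr_ge0; lra.
  have H1 : (1 + dotp a' b')^-1 <= 1 by rewrite invf_le1//; lra.
  have H2 : `|dotp (y *m P) b'| <= 2 * tau * eps.
    rewrite (_ : dotp _ b' = dotp (y *m P) (b' - a')); last first.
      by rewrite dotpDr dotpNr yP subr0.
    rewrite (le_trans (norm_dotp_le _ _))// enorm_mulmx// mulrC.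
    by rewrite ler_pM ?enorm_ge0 ?(ltW ye)// enormB.
  have H3 : enorm (a' + b') <= 2 by rewrite (le_trans (enormD _ _))// a'1 b'1; lra.
  have H4 : 0 <= (1 + dotp a' b')^-1 by rewrite invr_ge0; lra.
  have H5 : (1 + dotp a' b')^-1 * `|dotp (y *m P) b'| <= 1 * (2 * tau * eps).
    by rewrite ler_pM.
  have := ler_pM (mulr_ge0 H4 (normr_ge0 _)) (enorm_ge0 _) H5 H3.
  by move=> /le_trans; apply; lra.
apply: (le_trans (@radial_bracket_le g xi _ eps N (16 * tau ^+ 2) 0
  _ _ _ _ _ _ _ _)) => //; try lra.
- rewrite (_ : 16 * _ * _ = (4 * tau * eps) ^+ 2); last by ring.
  by rewrite ler_sqr ?nnegrE ?enorm_ge0 ?mulr_ge0 ?(ltW eps0).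
- by rewrite mul0r.
- rewrite ler_wpM2l ?sqr_ge0//; nra.
Qed.

End coupling.

(** * One step of the coupled games *)

(* lra compares atoms up to conversion, which is very slow on norms of vectors:
   abstract them first and keep only the facts pushed into the goal. *)
Ltac atoms_lra :=
  repeat match goal with
  | H : ?P |- _ => lazymatch type of P with Prop => clear H end
  end;
  repeat match goal with H := _ |- _ => clearbody H end;
  repeat match goal with
  | |- context [enorm ?a] => generalize (enorm a); intro
  | |- context [dotp ?a ?b] => generalize (dotp a b); intro
  | |- context [powR ?a ?b] => generalize (powR a b); intro
  | f : _ -> ?T |- context [?f ?a] =>
      lazymatch type of (f a) with
      | Num.RealDomain.sort _ => generalize (f a); intro
      | Real.sort _ => generalize (f a); intro
      end
  end;
  intros; lra.

Section improvement.
Context {R : realType} {m : nat}.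
Implicit Types (u : 'rV[R]_m.+1 -> R) (x z nu xi v w : 'rV[R]_m.+1).

(* u(x') - u(z') <= K + f(x', z') at all pairs reachable from (x, z) in one
   step, with f the comparison function of the header. *)
Definition displaced_bound u (K C D g eps : R) (f2 : R -> R)
    (x1 z1 x z : 'rV[R]_m.+1) : Prop :=
  forall v w, enorm v <= eps -> enorm w <= eps ->
  u (x + v) - u (z + w) <= K + C * enorm (x - z + (v - w)) `^ g
    + D * (enorm (x + v - x1) ^+ 2 + enorm (z + w - z1) ^+ 2)
    - f2 (enorm (x - z + (v - w))).

(** The penalty that keeps nearly maximizing pairs close to (x1, z1). *)
Definition localizer (D : R) (x1 z1 x z : 'rV[R]_m.+1) : R :=
  D * (enorm (x - x1) ^+ 2 + enorm (z - z1) ^+ 2).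

Lemma sqr_enorm_shift_le (r eps : R) v w : enorm v <= r -> enorm w <= eps ->
  eps <= r -> enorm (v + w) ^+ 2 <= enorm v ^+ 2 + 3 * r * eps.
Proof.
move=> vr we er; rewrite sqr_enormD.
have v0 := enorm_ge0 v; have w0 := enorm_ge0 w.
have H1 := dotp_le v w.
have H2 : enorm v * enorm w <= r * eps by rewrite ler_pM.
have H3 : enorm w * enorm w <= r * eps by rewrite ler_pM// (le_trans we).
by rewrite (expr2 (enorm w)); lra.
Qed.

Section bounds.
Variables (u : 'rV[R]_m.+1 -> R) (K C D g eps r : R) (f2 : R -> R).
Variables (x1 z1 x z : 'rV[R]_m.+1).
Hypothesis HK : displaced_bound u K C D g eps f2 x1 z1 x z.
Hypothesis f2_ge0 : forall s, 0 <= f2 s.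

Local Notation xi := (x - z).
Local Notation L0 := (localizer D x1 z1 x z).

(** For opposite displacements the parallelogram law cancels the first order terms of the penalty,
    which then costs only 2 D eps^2 per pair. *)
Lemma sym_bound v w : 0 <= C -> 0 <= D -> 0 <= g <= 1 -> xi != 0 ->
  enorm v <= eps -> enorm w <= eps -> enorm (v - w) < enorm xi ->
  u (x + v) + u (x - v) - (u (z + w) + u (z - w)) <=
  (K + L0 + 2 * D * eps ^+ 2
   + C * enorm xi `^ g * (1 + g / 2 * radial_bracket g xi (v - w))) *+ 2.
Proof.
move=> C0 D0 g01 xi0 ve we vw.
have E a b : enorm (a + b) ^+ 2 + enorm (a - b) ^+ 2 =
    2 * enorm a ^+ 2 + 2 * enorm b ^+ 2 :> R.
  by rewrite !sqr_enormD enormN dotpNr; ring.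
have Ex : enorm (x + v - x1) ^+ 2 + enorm (x - v - x1) ^+ 2 =
    2 * enorm (x - x1) ^+ 2 + 2 * enorm v ^+ 2.
  by rewrite (addrAC x v) (addrAC x (- v)) E.
have Ez : enorm (z + w - z1) ^+ 2 + enorm (z - w - z1) ^+ 2 =
    2 * enorm (z - z1) ^+ 2 + 2 * enorm w ^+ 2.
  by rewrite (addrAC z w) (addrAC z (- w)) E.
have e0 := le_trans (enorm_ge0 v) ve.
have v2 : enorm v ^+ 2 <= eps ^+ 2 by rewrite lerXn2r ?nnegrE ?enorm_ge0.
have w2 : enorm w ^+ 2 <= eps ^+ 2 by rewrite lerXn2r ?nnegrE ?enorm_ge0.
have := HK ve we; have := @HK (- v) (- w).
rewrite !enormN => /(_ ve we).
rewrite (_ : - v - - w = - (v - w)); last by rewrite opprB opprK addrC.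
have := f2_ge0 (enorm (xi + (v - w))); have := f2_ge0 (enorm (xi - (v - w))).
have := ler_wpM2l C0 (enorm_powR_sym_le g01 xi0 vw).
rewrite -/(radial_bracket g xi (v - w)).
have := ler_wpM2l D0 v2; have := ler_wpM2l D0 w2.
have := congr1 (fun k => D * k) Ex; have := congr1 (fun k => D * k) Ez.
rewrite /localizer mulr2n; move: (radial_bracket _ _ _) => rb.
atoms_lra.
Qed.

(** Each of the two square distances in the penalty grows by at most 3 r eps, whence 6 D r eps. *)
Lemma first_order_bound v w : 0 <= C -> 0 <= D -> 0 <= g <= 1 -> xi != 0 ->
  enorm (x - x1) <= r -> enorm (z - z1) <= r -> eps <= r ->
  enorm v <= eps -> enorm w <= eps ->
  u (x + v) - u (z + w) <= K + L0 + 6 * D * r * eps + C * enorm xi `^ g *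
    (1 + g / 2 * (2 * dotp xi (v - w) / enorm xi ^+ 2
                  + 4 * eps ^+ 2 / enorm xi ^+ 2)).
Proof.
move=> C0 D0 g01 xi0 xr zr er ve we.
have := HK ve we; have := f2_ge0 (enorm (xi + (v - w))).
have g02 : 0 <= g <= 2 by move: g01; atoms_lra.
have H1 := ler_wpM2l C0 (enorm_powR_le (v - w) g02 xi0).
have H2 : D * enorm (x + v - x1) ^+ 2 <= D * (enorm (x - x1) ^+ 2 + 3 * r * eps).
  by rewrite ler_wpM2l// (addrAC x v) sqr_enorm_shift_le.
have H3 : D * enorm (z + w - z1) ^+ 2 <= D * (enorm (z - z1) ^+ 2 + 3 * r * eps).
  by rewrite ler_wpM2l// (addrAC z w) sqr_enorm_shift_le.
have t0 : 0 < enorm xi by rewrite enorm_gt0.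
have H4 : enorm (v - w) ^+ 2 / enorm xi ^+ 2 <= 4 * eps ^+ 2 / enorm xi ^+ 2.
  rewrite ler_pM2r ?invr_gt0 ?exprn_gt0//.
  have H : enorm (v - w) <= 2 * eps.
    by rewrite (le_trans (enormD _ _))// enormN; move: ve we; atoms_lra.
  have H' := enorm_ge0 (v - w).
  have := ler_pM H' H' H H; rewrite -!expr2; atoms_lra.
have H5 : 0 <= C * enorm xi `^ g * (g / 2).
  by rewrite !mulr_ge0 ?powR_ge0 ?invr_ge0//; move: g01; atoms_lra.
have H6 := ler_wpM2l H5 H4.
rewrite /localizer; move: H1 H2 H3 H6; atoms_lra.
Qed.

(** For close points no expansion is made: the new distance is at most (N + 2) eps, and (N + 2)^g <=
    N + 2. The term in [f2] is kept, as it provides the gain. *)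
Lemma crude_bound N v w : 0 <= C -> 0 <= D -> 0 <= g <= 1 -> 0 < N -> 0 < eps ->
  enorm xi <= N * eps ->
  enorm (x - x1) <= r -> enorm (z - z1) <= r -> eps <= r ->
  enorm v <= eps -> enorm w <= eps ->
  u (x + v) - u (z + w) <= K + L0 + 6 * D * r * eps + C * ((N + 2) * eps `^ g)
    - f2 (enorm (xi + (v - w))).
Proof.
move=> C0 D0 /andP[g0 g1] N0 e0 xiN xr zr er ve we.
have := HK ve we.
have H2 : D * enorm (x + v - x1) ^+ 2 <= D * (enorm (x - x1) ^+ 2 + 3 * r * eps).
  by rewrite ler_wpM2l// (addrAC x v) sqr_enorm_shift_le.
have H3 : D * enorm (z + w - z1) ^+ 2 <= D * (enorm (z - z1) ^+ 2 + 3 * r * eps).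
  by rewrite ler_wpM2l// (addrAC z w) sqr_enorm_shift_le.
have H1 : enorm (xi + (v - w)) `^ g <= (N + 2) * eps `^ g.
  apply: (@le_trans _ _ (((N + 2) * eps) `^ g)).
    apply: ge0_ler_powR; rewrite ?nnegrE ?enorm_ge0 ?mulr_ge0 ?(ltW e0)//.
      by move: N0; atoms_lra.
    have := enormD xi (v - w); have := enormD v (- w); rewrite enormN.
    by move: ve we xiN; atoms_lra.
  rewrite powRM ?(ltW e0)//; last by move: N0; atoms_lra.
  by rewrite ler_wpM2r ?powR_ge0// ler1_powR//; move: N0; atoms_lra.
have := ler_wpM2l C0 H1; rewrite /localizer; move: H2 H3; atoms_lra.
Qed.

End bounds.

End improvement.

Section moves.
Context {R : realType} {m : nat}.
Implicit Types (xi : 'rV[R]_m.+1).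

(** Points farther apart than 2 eps move radially. Closer ones can meet exactly: each covers half of
    xi, and a common orthogonal component makes the step length eps. The orthogonal direction
    requires dimension at least 2. *)
Lemma meeting_moves (eps : R) xi : (0 < m)%N -> 0 < eps -> xi != 0 ->
  exists mx mz, [/\ enorm mx = eps, enorm mz = eps &
    enorm (xi + (mx - mz)) = Num.max (enorm xi - 2 * eps) 0].
Proof.
move=> m0 e0 xi0; have t0 : 0 < enorm xi by rewrite enorm_gt0.
have [et|et] := leP (2 * eps) (enorm xi).
  exists (- ((eps / enorm xi) *: xi)), ((eps / enorm xi) *: xi).
  rewrite enormN !enorm_direction//; split=> //.
  rewrite -opprD -scalerDl -{1}[xi]scale1r -scalerBl enormZ max_l ?subr_ge0//.
  rewrite ger0_norm.
    by rewrite mulrBl mul1r mulrDl divfK ?gt_eqF//; lra.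
  by rewrite subr_ge0 -mulrDl ler_pdivrMr// mul1r; lra.
pose i0 : 'I_m := Ordinal m0.
pose y : 'rV[R]_m := delta_mx 0 i0; pose p := y *m frame xi.
have fP := frameP xi0.
have p1 : enorm p = 1 by rewrite enorm_mulmx ?fP.1// enorm_delta.
have pxi : dotp p xi = 0 by exact: is_frame_dotp.
pose s := Num.sqrt (eps ^+ 2 - enorm xi ^+ 2 / 4).
have s2 : s ^+ 2 = eps ^+ 2 - enorm xi ^+ 2 / 4.
  have et' : enorm xi <= 2 * eps by rewrite ltW.
  rewrite sqr_sqrtr//.
  have := ler_pM (ltW t0) (ltW t0) et' et'; rewrite -!expr2; lra.
have N1 (k : R) : `|k| = 2^-1 -> enorm (k *: xi + s *: p) = eps.
  move=> kE; apply/eqP; rewrite -(eqrXn2 (isT : (0 < 2)%N)) ?enorm_ge0 ?(ltW e0)//.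
  rewrite sqr_enormD !enormZ p1 mulr1 dotpZl dotpZr (dotpC xi) pxi !mulr0 addr0.
  by rewrite exprMn !real_normK ?num_real// s2 -[k ^+ 2]real_normK ?num_real// kE;
    apply/eqP; field.
exists (- 2^-1 *: xi + s *: p), (2^-1 *: xi + s *: p); split.
- by apply: N1; rewrite normrN ger0_norm.
- by apply: N1; rewrite ger0_norm.
rewrite max_r; last by lra.
rewrite opprD addrACA subrr addr0 scaleNr -opprD -scalerDl.
rewrite (_ : 2^-1 + 2^-1 = 1 :> R); last by field.
by rewrite scale1r subrr enorm0.
Qed.

End moves.

(** * Bounds for a pair of moves, and the reply for close points *)

Section cases.
Context {R : realType} {m : nat}.
Variables (u : 'rV[R]_m.+1 -> R) (K C D g eps r N ax az : R) (f2 : R -> R).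
Variables (x1 z1 x z : 'rV[R]_m.+1).

Local Notation xi := (x - z).
Local Notation L0 := (localizer D x1 z1 x z).
Local Notation Wx := (mixed_value ax eps u x).
Local Notation Wz := (mixed_value az eps u z).

Definition one_step_setting : Prop :=
  [/\ displaced_bound u K C D g eps f2 x1 z1 x z,
      forall s, 0 <= f2 s,
      [/\ 0 <= C, 0 <= D, 0 < g < 1, 0 < N & 0 < eps <= r],
      [/\ enorm (x - x1) <= r, enorm (z - z1) <= r & xi != 0] &
      [/\ 0 <= ax <= 1, 0 <= az <= 1 & forall nu, enorm nu = eps ->
        W_well_defined eps u x nu /\ W_well_defined eps u z nu]].

(** Tug is coupled with tug as often as possible, with probability min(ax, az); then both are noise
    with probability 1 - max(ax, az). *)
Lemma coupling_weights : 0 <= ax <= 1 -> 0 <= az <= 1 ->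
  [/\ 0 <= Num.min ax az, Num.min ax az <= ax, Num.min ax az <= az &
      ax + az - Num.min ax az <= 1].
Proof.
move=> /andP[x0 xl] /andP[z0 zl].
by have [h|h] := leP ax az; split => //; lra.
Qed.

Lemma direction_neq0 (nu : 'rV[R]_m.+1) : 0 < eps -> enorm nu = eps -> nu != 0.
Proof. by move=> e0 nuE; rewrite -enorm_gt0 nuE. Qed.

(** Only the tug-tug event, of probability min(ax, az), retains its [f2] term; elsewhere [f2] is
    dropped by positivity, and any frames serve for the noise. *)
Lemma crude_config nu nu' : one_step_setting -> enorm xi <= N * eps ->
  enorm nu = eps -> enorm nu' = eps ->
  Wx nu - Wz nu' <= K + L0 + 6 * D * r * eps + C * ((N + 2) * eps `^ g)
    - Num.min ax az * f2 (enorm (xi + (nu - nu'))).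
Proof.
move=> [HK f0 [C0 D0 /andP[g0 g1] N0 /andP[e0 er]] [xr zr xi0] [ax1 az1 Wd]].
move=> xiN nE nE'; have [c0 cx cz c1] := coupling_weights ax1 az1.
have g01 : 0 <= g <= 1 by rewrite !ltW.
have nu0 := direction_neq0 e0 nE; have nu0' := direction_neq0 e0 nE'.
have fP := frameP nu0; have fQ := frameP nu0'.
have yP P y nu1 : is_frame nu1 P -> enorm (y : 'rV[R]_m) < eps ->
    enorm (y *m P) <= eps.
  by move=> [PP _] ye; rewrite enorm_mulmx// ltW.
set c := Num.min ax az in c0 cx cz c1 *.
set B := K + L0 + 6 * D * r * eps + C * ((N + 2) * eps `^ g).
have HB v w : enorm v <= eps -> enorm w <= eps ->
    u (x + v) - u (z + w) <= B - f2 (enorm (xi + (v - w))).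
  by move=> ve we; exact: (crude_bound HK C0 D0 g01 N0 e0 xiN xr zr er ve we).
have HB' v w : enorm v <= eps -> enorm w <= eps -> u (x + v) - u (z + w) <= B.
  move=> ve we; have := HB _ _ ve we; have := f0 (enorm (xi + (v - w))); atoms_lra.
have Ne (v : 'rV[R]_m.+1) : enorm v <= eps -> enorm (- v) <= eps.
  by rewrite enormN.
have nle : enorm nu <= eps by rewrite nE.
have nle' : enorm nu' <= eps by rewrite nE'.
have := @coupling_le _ ax az c (u (x + nu)) (u (z + nu'))
  (hyperplane_mean eps u x nu) (hyperplane_mean eps u z nu')
  (B - f2 (enorm (xi + (nu - nu')))) B B B c0 cx cz c1.
move=> H; apply: le_trans (H _ _ _ _) _; last by atoms_lra.
- exact: HB.
- rewrite lerBlDl -lerBlDr.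
  apply: (hyperplane_mean_ge e0 nu0' fQ (Wd _ nE').2) => y /(yP _ _ _ fQ) ye.
  have h : u (x + nu) - u (z - y *m frame nu') <= B := HB' _ _ nle (Ne _ ye).
  have := HB' _ _ nle ye; move: h; rewrite -mulr_natl.
  by atoms_lra.
- rewrite lerBlDl.
  apply: (hyperplane_mean_le e0 nu0 fP (Wd _ nE).1) => y /(yP _ _ _ fP) ye.
  have h : u (x - y *m frame nu) - u (z + nu') <= B := HB' _ _ (Ne _ ye) nle'.
  have := HB' _ _ ye nle'; move: h; rewrite -mulr_natl.
  by atoms_lra.
- apply: (hyperplane_mean_diff_le e0 nu0 nu0' fP fQ (Wd _ nE).1 (Wd _ nE').2).
  move=> y ye; have yeP := yP _ _ _ fP ye; have yeQ := yP _ _ _ fQ ye.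
  have h : u (x - y *m frame nu) - u (z - y *m frame nu') <= B :=
    HB' _ _ (Ne _ yeP) (Ne _ yeQ).
  have := HB' _ _ yeP yeQ; move: h.
  by rewrite -mulr_natl; atoms_lra.
Qed.

(** The one-step bound is affine in xi.v - xi.w. The noise contributes nothing to first order by
    symmetry, so only the tugs remain, with weights ax and az. *)
Lemma first_order_config nu nu' : one_step_setting ->
  enorm nu = eps -> enorm nu' = eps ->
  Wx nu - Wz nu' <= K + L0 + 6 * D * r * eps + C * enorm xi `^ g *
    (1 + g / 2 * (2 * (ax * dotp xi nu - az * dotp xi nu') / enorm xi ^+ 2
                  + 4 * eps ^+ 2 / enorm xi ^+ 2)).
Proof.
move=> [HK f0 [C0 D0 /andP[g0 g1] N0 /andP[e0 er]] [xr zr xi0] [ax1 az1 Wd]].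
move=> nE nE'; have [c0 cx cz c1] := coupling_weights ax1 az1.
have g01 : 0 <= g <= 1 by rewrite !ltW.
have nu0 := direction_neq0 e0 nE; have nu0' := direction_neq0 e0 nE'.
have fP := frameP nu0; have fQ := frameP nu0'.
have yP P y nu1 : is_frame nu1 P -> enorm (y : 'rV[R]_m) < eps ->
    enorm (y *m P) <= eps.
  by move=> [PP _] ye; rewrite enorm_mulmx// ltW.
set c := Num.min ax az in c0 cx cz c1 *.
pose b (s : R) := K + L0 + 6 * D * r * eps + C * enorm xi `^ g *
    (1 + g / 2 * (2 * s / enorm xi ^+ 2 + 4 * eps ^+ 2 / enorm xi ^+ 2)).
pose k := C * enorm xi `^ g * (g / 2) * 2 / enorm xi ^+ 2.
have bE s : b s = b 0 + k * s by rewrite /b /k; ring.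
have HB v w : enorm v <= eps -> enorm w <= eps ->
    u (x + v) - u (z + w) <= b 0 + k * (dotp xi v - dotp xi w).
  move=> ve we; rewrite -bE -dotpNr -dotpDr.
  exact: (first_order_bound HK f0 C0 D0 g01 xi0 xr zr er ve we).
have nle : enorm nu <= eps by rewrite nE.
have nle' : enorm nu' <= eps by rewrite nE'.
have Ne (v : 'rV[R]_m.+1) : enorm v <= eps -> enorm (- v) <= eps.
  by rewrite enormN.
have := @coupling_le _ ax az c (u (x + nu)) (u (z + nu'))
  (hyperplane_mean eps u x nu) (hyperplane_mean eps u z nu')
  (b 0 + k * (dotp xi nu - dotp xi nu')) (b 0 + k * dotp xi nu)
  (b 0 - k * dotp xi nu') (b 0) c0 cx cz c1.
move=> H; apply: le_trans (H _ _ _ _) _; last first.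
- by rewrite -/(b _) [leRHS]bE; move: (b 0) => b0; atoms_lra.
- apply: (hyperplane_mean_diff_le e0 nu0 nu0' fP fQ (Wd _ nE).1 (Wd _ nE').2).
  move=> y ye; have yeP := yP _ _ _ fP ye; have yeQ := yP _ _ _ fQ ye.
  have h : u (x - y *m frame nu) - u (z - y *m frame nu') <= _ :=
    HB _ _ (Ne _ yeP) (Ne _ yeQ).
  have := HB _ _ yeP yeQ; move: h.
  by rewrite !dotpNr -mulr_natl; atoms_lra.
- rewrite lerBlDl.
  apply: (hyperplane_mean_le e0 nu0 fP (Wd _ nE).1) => y /(yP _ _ _ fP) ye.
  have h : u (x - y *m frame nu) - u (z + nu') <= _ := HB _ _ (Ne _ ye) nle'.
  have := HB _ _ ye nle'; move: h.
  by rewrite dotpNr -mulr_natl; atoms_lra.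
- rewrite lerBlDl -lerBlDr.
  apply: (hyperplane_mean_ge e0 nu0' fQ (Wd _ nE').2) => y /(yP _ _ _ fQ) ye.
  have h : u (x + nu) - u (z - y *m frame nu') <= _ := HB _ _ nle (Ne _ ye).
  have := HB _ _ nle ye; move: h.
  by rewrite dotpNr -mulr_natl; atoms_lra.
- exact: HB.
Qed.

(** The reply [meeting_moves] is independent of nx and nz. Half of its [f2] gain, weighted by
    min(ax, az), must pay for all other terms; this is the hypothesis on [f2]. *)
Lemma near_case : (0 < m)%N -> one_step_setting -> enorm xi <= N * eps ->
  6 * D * r * eps + C * ((N + 2) * eps `^ g) + f2 (enorm xi) + eps ^+ 2 <=
    Num.min ax az / 2 * f2 (Num.max (enorm xi - 2 * eps) 0) ->
  exists mx mz, [/\ enorm mx = eps, enorm mz = eps & forall nx nz,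
    enorm nx = eps -> enorm nz = eps ->
    (Wx nx - Wz nz) / 2 + (Wx mx - Wz mz) / 2 <=
    K + (C * enorm xi `^ g + L0 - f2 (enorm xi)) - eps ^+ 2].
Proof.
move=> m0 S xiN H.
have [HK f0 [C0 D0 g01 N0 /andP[e0 er]] [xr zr xi0] [ax1 az1 Wd]] := S.
have [mx [mz [mxE mzE mm]]] := meeting_moves m0 e0 xi0.
exists mx, mz; split=> // nx nz nxE nzE.
have := crude_config S xiN nxE nzE; have := crude_config S xiN mxE mzE.
rewrite mm; have [c0 _ _ _] := coupling_weights ax1 az1.
have := mulr_ge0 c0 (f0 (enorm (xi + (nx - nz)))).
have := mulr_ge0 C0 (powR_ge0 (enorm xi) g).
move: H; atoms_lra.
Qed.

End cases.

(** * Replies for distant points *)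

Section far_cases.
Context {R : realType} {m : nat}.
Variables (u : 'rV[R]_m.+1 -> R) (K C D g eps r N ax az : R) (f2 : R -> R).
Variables (x1 z1 x z : 'rV[R]_m.+1).

Local Notation xi := (x - z).
Local Notation L0 := (localizer D x1 z1 x z).
Local Notation Wx := (mixed_value ax eps u x).
Local Notation Wz := (mixed_value az eps u z).
Local Notation setting :=
  (one_step_setting u K C D g eps r N ax az f2 x1 z1 x z).

(** Bounds |xi|^(g - 1) below in terms of the upper bound T for |xi|; the cases t <= 1 and t > 1 use
    t^g >= t and t^g >= 1. *)
Lemma powR_div_ge (t T : R) : 0 < g < 1 -> 0 < t -> t <= T -> 1 <= T ->
  T^-1 <= t `^ g / t.
Proof.
move=> /andP[g0 g1] t0 tT T1; have T0 : 0 < T by lra.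
rewrite ler_pdivlMr// mulrC ler_pdivrMr//.
have [t1|t1] := leP t 1.
  have : t <= t `^ g by rewrite ger1_powR// ?t0//; exact: ltW.
  have := powR_ge0 t g; nra.
have : 1 <= t `^ g.
  by have -> : 1 = 1 `^ g; [rewrite powR1|rewrite ge0_ler_powR ?nnegrE; lra].
have := powR_ge0 t g; nra.
Qed.

Lemma far_misaligned_case (a0 tau T : R) nx nz : setting ->
  N * eps <= enorm xi -> 0 < a0 -> a0 <= ax -> a0 <= az -> eps <= 1 ->
  16 <= N * (a0 * tau ^+ 2) -> enorm xi <= T -> 1 <= T ->
  6 * D * r + 1 <= C * (g / 8) * a0 * tau ^+ 2 / T ->
  enorm nx = eps -> enorm nz = eps ->
  dotp xi nx <= (1 - tau ^+ 2 / 2) * (eps * enorm xi) \/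
  - ((1 - tau ^+ 2 / 2) * (eps * enorm xi)) <= dotp xi nz ->
  exists mx mz, [/\ enorm mx = eps, enorm mz = eps &
    (Wx nx - Wz nz) / 2 + (Wx mx - Wz mz) / 2 <=
    K + (C * enorm xi `^ g + L0) - eps ^+ 2].
Proof.
move=> S Nxi a00 a0x a0z e1 Nb xiT T1 Cb nxE nzE H.
have [_ _ [C0 D0 g01 N0 /andP[e0 er]] [xr zr xi0] [ax1 az1 _]] := S.
have t0 : 0 < enorm xi by rewrite enorm_gt0.
pose e := (eps / enorm xi) *: xi; have eE : enorm e = eps by exact: enorm_direction.
have meE : enorm (- e) = eps by rewrite enormN.
exists (- e), e; split=> //.
have := first_order_config S nxE nzE; have := first_order_config S meE eE.
have -> : dotp xi (- e) = - (eps * enorm xi).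
  by rewrite dotpNr dotpZr -sqr_enorm; congr (- _); field; rewrite gt_eqF.
have -> : dotp xi e = eps * enorm xi.
  by rewrite dotpZr -sqr_enorm; field; rewrite gt_eqF.
have nx1 : dotp xi nx <= eps * enorm xi.
  by rewrite (le_trans (dotp_le _ _))// nxE mulrC.
have nz1 : - (eps * enorm xi) <= dotp xi nz.
  rewrite lerNl -dotpNr (le_trans (dotp_le _ _))// enormN nzE mulrC//.
have := powR_div_ge g01 t0 xiT T1.
have := powR_ge0 (enorm xi) g.
move: (Wx nx) (Wz nz) (Wx (- e)) (Wz e) (dotp xi nx) (dotp xi nz) nx1 nz1 H
  (enorm xi `^ g) L0 => w1 w2 w3 w4 dx dz nx1 nz1 H tg l0.
move: (enorm xi) t0 nx1 nz1 H Nxi xiT => t t0 nx1 nz1 H Nxi xiT.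
clear S nxE nzE eE meE xr zr xi0; clear e.
move=> tg0 tT.
have et0 : 0 < eps * t by rewrite mulr_gt0.
have tau0 := sqr_ge0 tau.
(* It suffices that one of nx, nz is misaligned: the other term has the right sign by
   Cauchy-Schwarz. *)
have A : ax * (dx - eps * t) - az * (dz + eps * t) <= - (a0 * tau ^+ 2 / 2 * (eps * t)).
  have h : 0 <= tau ^+ 2 / 2 * (eps * t) by rewrite mulr_ge0 ?divr_ge0// ltW.
  case: H => H.
    have h1 : (ax - a0) * (dx - eps * t) <= 0 by rewrite mulr_ge0_le0; lra.
    have h2 : 0 <= az * (dz + eps * t) by rewrite mulr_ge0; lra.
    have h3 : a0 * (dx - eps * t) <= a0 * - (tau ^+ 2 / 2 * (eps * t)).
      by rewrite ler_wpM2l ?(ltW a00)//; lra.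
    lra.
  have h1 : 0 <= (az - a0) * (dz + eps * t) by rewrite mulr_ge0; lra.
  have h2 : ax * (dx - eps * t) <= 0 by rewrite mulr_ge0_le0; lra.
  have h3 : a0 * (tau ^+ 2 / 2 * (eps * t)) <= a0 * (dz + eps * t).
    by rewrite ler_wpM2l ?(ltW a00)//; lra.
  lra.
(* The size of N makes the second order error at most half of the first order gain. *)
have E4 : 4 * eps ^+ 2 <= a0 * tau ^+ 2 / 4 * (eps * t).
  have h : N * eps * (a0 * tau ^+ 2) <= t * (a0 * tau ^+ 2).
    by rewrite ler_wpM2r// mulr_ge0// ltW.
  have h' : 16 * eps <= t * (a0 * tau ^+ 2).
    by rewrite (le_trans _ h)// mulrAC ler_wpM2r// ltW.
  have := ler_wpM2l (ltW e0) h'; rewrite expr2; lra.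
(* The common coefficient of the first and second order terms; the condition on C makes q times the
   remaining gain at least (6 D r + 1) eps. *)
pose q := C * tg * (g / 2) / t ^+ 2.
have q0 : 0 <= q.
  by case/andP: g01 => g0 g1; rewrite divr_ge0 ?sqr_ge0// !mulr_ge0// ?invr_ge0// ltW.
have AE : ax * (dx - eps * t) - az * (dz + eps * t) + 4 * eps ^+ 2 <=
  - (a0 * tau ^+ 2 / 4 * (eps * t)) by lra.
have qAE := ler_wpM2l q0 AE.
have qE : q * (a0 * tau ^+ 2 / 4 * (eps * t)) =
    C * (g / 8) * a0 * tau ^+ 2 * (tg / t) * eps.
  by rewrite /q; field; rewrite gt_eqF.
have Cb' : (6 * D * r + 1) * eps <= C * (g / 8) * a0 * tau ^+ 2 * (tg / t) * eps.
  rewrite ler_wpM2r ?(ltW e0)// (le_trans Cb)// ler_wpM2l//.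
  have g8 : 0 <= g / 8 by case/andP: g01 => g0 _; rewrite divr_ge0 ?(ltW g0).
  exact: (mulr_ge0 (mulr_ge0 (mulr_ge0 C0 g8) (ltW a00)) tau0).
have e2 : eps ^+ 2 <= eps by rewrite expr2 ler_piMr// ltW.
have qEs s : C * tg * (1 + g / 2 * (2 * s / t ^+ 2 + 4 * eps ^+ 2 / t ^+ 2)) =
    C * tg + q * (2 * s + 4 * eps ^+ 2) by rewrite /q; field; rewrite gt_eqF.
rewrite !qEs; clear qEs AE E4 A H; clearbody q; move=> B1 B2; lra.
Qed.

(** The opposite reply symmetrizes the tugs, so only the four brackets matter, averaged with the
    coupling weights. Here g ax <= az and g az <= ax make the tug-tug gain outweigh the tug-noise
    losses. *)
Lemma far_aligned_case (a0 tau T : R) nx nz : setting ->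
  N * eps <= enorm xi -> 4 <= N -> 0 < a0 -> a0 <= ax -> a0 <= az ->
  g * ax <= az -> g * az <= ax ->
  tau = (1 - g) * a0 / 16 -> 64 <= (1 - g) * a0 * N ^+ 2 ->
  enorm xi <= T -> 1 <= T ->
  2 * D + 1 <= C * (g / 2) * ((1 - g) * a0) / T ^+ 2 ->
  enorm nx = eps -> enorm nz = eps ->
  almost_aligned tau eps xi nx -> almost_aligned tau eps xi (- nz) ->
  (Wx nx - Wz nz) / 2 + (Wx (- nx) - Wz (- nz)) / 2 <=
    K + (C * enorm xi `^ g + L0) - eps ^+ 2.
Proof.
move=> S Nxi N4 a00 a0x a0z gxz gzx tauE Nb xiT T1 Cb nxE nzE Ax Az.
have [HK f0 [C0 D0 g01 N0 /andP[e0 er]] [xr zr xi0] [ax1 az1 Wd]] := S.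
have g01' : 0 <= g <= 1 by case/andP: g01 => ? ?; rewrite !ltW.
have t0 : 0 < enorm xi by rewrite enorm_gt0.
have ga0 : 0 < (1 - g) * a0.
  by rewrite mulr_gt0//; case/andP: g01; atoms_lra.
have ga1 : (1 - g) * a0 <= 1.
  by rewrite mulr_ile1//; move: g01 a00 a0x ax1; atoms_lra.
have tau16 : 0 <= tau <= 1 / 16.
  by rewrite tauE; move: ga0 ga1; atoms_lra.
have [tau0 tau1] := andP tau16.
have [c0 cx cz c1] := coupling_weights ax1 az1; set c := Num.min ax az in c0 cx cz c1.
have nx0 := direction_neq0 e0 nxE; have nz0 := direction_neq0 e0 nzE.
set P := frame nx; have fP : is_frame nx P := frameP nx0.
(* The noise at z uses the frame of nx rotated to - nz; changing the sign of the direction makes it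
   a frame for nz. *)
pose Q := rotate_frame (eps^-1 *: nx) (eps^-1 *: - nz) P.
have ab := almost_aligned_dotp tau16 e0 xi0 Ax Az.
have un (v : 'rV[R]_m.+1) : enorm v = eps -> enorm (eps^-1 *: v) = 1.
  by move=> vE; rewrite enormZ ger0_norm ?invr_ge0 ?(ltW e0)// vE mulVf// gt_eqF.
have fQ : is_frame nz Q.
  have /(is_frameZ (- eps)) : is_frame (eps^-1 *: - nz) Q.
    apply: rotate_frameP (is_frameZ _ fP); rewrite ?un ?enormN//.
    by rewrite gt_eqF// (lt_le_trans _ ab).
  by rewrite scalerA mulNr mulfV ?gt_eqF// scaleN1r opprK.
have neE (v : 'rV[R]_m.+1) : enorm v = eps -> enorm (- v) = eps by rewrite enormN.
have Mx := hyperplane_meanN nx0 (Wd _ nxE).1 (Wd _ (neE nx nxE)).1.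
have Mz := hyperplane_meanN nz0 (Wd _ nzE).2 (Wd _ (neE nz nzE)).2.
pose b s := K + L0 + 2 * D * eps ^+ 2 +
  C * enorm xi `^ g * (1 + g / 2 * ((eps / enorm xi) ^+ 2 * s)).
have HB v w s : enorm v <= eps -> enorm w <= eps ->
    radial_bracket g xi (v - w) <= (eps / enorm xi) ^+ 2 * s ->
    (u (x + v) + u (x - v)) - (u (z + w) + u (z - w)) <= 2 * b s.
  move=> ve we vws.
  have vw : enorm (v - w) < enorm xi.
    have : enorm (v - w) <= enorm v + enorm w.
      by rewrite (le_trans (enormD _ _))// enormN.
    have : 4 * eps <= N * eps by rewrite ler_wpM2r ?(ltW e0).
    by move: ve we e0 Nxi; atoms_lra.
  apply: le_trans (sym_bound HK f0 C0 D0 g01' xi0 ve we vw) _.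
  rewrite [leRHS]mulr_natl ler_pMn2r// lerD2l ler_wpM2l ?mulr_ge0 ?powR_ge0//.
  rewrite lerD2l ler_wpM2l//.
  by case/andP: g01' => ? _; rewrite divr_ge0.
have nxle : enorm nx <= eps by rewrite nxE.
have nzle : enorm nz <= eps by rewrite nzE.
have yP (y : 'rV[R]_m) : enorm y < eps -> enorm (y *m P) <= eps.
  by move=> ye; rewrite enorm_mulmx ?fP.1// ltW.
have yQ (y : 'rV[R]_m) : enorm y < eps -> enorm (y *m Q) <= eps.
  by move=> ye; rewrite enorm_mulmx ?fQ.1// ltW.
have n64 : 64 / N ^+ 2 <= (1 - g) * a0 by rewrite ler_pdivrMr ?exprn_gt0.
set n := 64 / N ^+ 2 in n64.
have bt : (u (x + nx) + u (x - nx)) / 2 - (u (z + nz) + u (z - nz)) / 2 <=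
    b (- 4 * (1 - g) + 16 * tau + n).
  rewrite -mulrBl ler_pdivrMr// mulrC; apply: HB => //.
  exact: tug_tug_bracket.
have btn : (u (x + nx) + u (x - nx)) / 2 - hyperplane_mean eps u z nz <=
    b (g + 12 * tau + n).
  rewrite lerBlDl -lerBlDr.
  apply: (hyperplane_mean_ge e0 nz0 fQ (Wd _ nzE).2) => y ye.
  have h : u (x + nx) + u (x - nx) - (u (z + y *m Q) + u (z - y *m Q)) <=
      2 * b (g + 12 * tau + n).
    apply: (HB _ _ _ nxle (yQ _ ye)).
    apply: (tug_noise_bracket g01' tau16 e0 N0 Nxi Ax Az) (yQ _ ye).
    by rewrite dotpNr (is_frame_dotp _ fQ) oppr0.
  by move: h; rewrite -mulr_natl; move: (b _) => bb; atoms_lra.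
have bnt : hyperplane_mean eps u x nx - (u (z + nz) + u (z - nz)) / 2 <=
    b (g + 12 * tau + n).
  rewrite lerBlDl.
  apply: (hyperplane_mean_le e0 nx0 fP (Wd _ nxE).1) => y ye.
  have h : u (x + y *m P) + u (x - y *m P) - (u (z + nz) + u (z - nz)) <=
      2 * b (g + 12 * tau + n).
    apply: (HB _ _ _ (yP _ ye) nzle).
    have nye : enorm (- (y *m P)) <= eps by rewrite enormN yP.
    have := tug_noise_bracket g01' tau16 e0 N0 Nxi Az Ax (h := - (y *m P)).
    rewrite opprK [- nz + _]addrC; apply => //.
    by rewrite dotpNl (is_frame_dotp _ fP) oppr0.
  by move: h; rewrite -mulr_natl; move: (b _) => bb; atoms_lra.
have bnn : hyperplane_mean eps u x nx - hyperplane_mean eps u z nz <=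
    b (16 * tau + n).
  apply: (hyperplane_mean_diff_le e0 nx0 nz0 fP fQ (Wd _ nxE).1 (Wd _ nzE).2).
  move=> y ye.
  have h : u (x + y *m P) + u (x - y *m P) - (u (z + y *m Q) + u (z - y *m Q)) <=
      2 * b (16 * tau + n).
    apply: (HB _ _ _ (yP _ ye) (yQ _ ye)).
    exact: noise_noise_bracket.
  by move: h; rewrite -mulr_natl; move: (b _) => bb; atoms_lra.
have := coupling_le c0 cx cz c1 bt btn bnt bnn.
rewrite /mixed_value Mx Mz.
have := powR_div_ge g01 t0 xiT T1.
move: (hyperplane_mean _ _ _ _) (hyperplane_mean _ _ _ _) => mx mz.
pose s := c * (- 4 * (1 - g) + 16 * tau + n) + (ax - c) * (g + 12 * tau + n) +
  (az - c) * (g + 12 * tau + n) + (1 - (ax + az - c)) * (16 * tau + n).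
have sE : c * b (- 4 * (1 - g) + 16 * tau + n) + (ax - c) * b (g + 12 * tau + n) +
  (az - c) * b (g + 12 * tau + n) + (1 - (ax + az - c)) * b (16 * tau + n) = b s.
  by rewrite /b /s; ring.
rewrite sE.
(* With c = min(ax, az): [h4] is g (max - min) <= (1 - g) c, while 16 tau and n are each at most (1
   - g) a0. Hence s <= -3 (1 - g) c + 2 (1 - g) a0, and c >= a0. *)
have s_le : s <= - ((1 - g) * a0).
  have h1 : 16 * tau = (1 - g) * a0 by rewrite tauE; field.
  have h2 : (ax - c) * (12 * tau) <= (ax - c) * (16 * tau).
    by rewrite ler_wpM2l ?subr_ge0//; move: tau0; atoms_lra.
  have h3 : (az - c) * (12 * tau) <= (az - c) * (16 * tau).
    by rewrite ler_wpM2l ?subr_ge0//; move: tau0; atoms_lra.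
  have h4 : g * (ax + az - 2 * c) <= (1 - g) * c.
    have [cE|cE] : c = ax \/ c = az by rewrite /c; case: leP; [left|right].
      by rewrite cE; move: gxz gzx; atoms_lra.
    by rewrite cE; move: gxz gzx; atoms_lra.
  have h5 : (1 - g) * a0 <= (1 - g) * c.
    rewrite ler_wpM2l//; first by case/andP: g01; atoms_lra.
    by rewrite /c le_min a0x a0z.
  rewrite /s; move: h1 h2 h3 h4 h5 n64; atoms_lra.
have bs : b s <= K + (C * enorm xi `^ g + L0) - eps ^+ 2.
  pose q := C * enorm xi `^ g * (g / 2) / enorm xi ^+ 2 * eps ^+ 2.
  have bE : b s = K + L0 + 2 * D * eps ^+ 2 + C * enorm xi `^ g + q * s.
    by rewrite /b /q; field; rewrite gt_eqF.
  have g2 : 0 <= C * (g / 2) by case/andP: g01' => ? _; rewrite mulr_ge0// divr_ge0.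
  have q0 : 0 <= q.
    rewrite /q mulr_ge0 ?sqr_ge0// divr_ge0 ?sqr_ge0// mulrAC mulr_ge0//.
    exact: powR_ge0.
  have h1 := ler_wpM2l q0 s_le.
  (* Of the gain, 2 D eps^2 pays for the penalty and eps^2 is the improvement. *)
  have h2 : (2 * D + 1) * eps ^+ 2 <= q * ((1 - g) * a0).
    have -> : q * ((1 - g) * a0) = C * (g / 2) * ((1 - g) * a0) *
        (enorm xi `^ g / enorm xi ^+ 2) * eps ^+ 2 by rewrite /q; ring.
    rewrite ler_wpM2r ?sqr_ge0// (le_trans Cb)// ler_wpM2l//.
      by rewrite mulr_ge0// ltW.
    have T0 : 0 < T by rewrite (lt_le_trans _ T1).
    rewrite !expr2 !invfM mulrA ler_pM// ?invr_ge0 ?(ltW T0)//.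
      exact: (powR_div_ge g01 t0 xiT T1).
    by rewrite lef_pV2.
  by rewrite bE; move: h1 h2; clearbody q; atoms_lra.
move=> h1 h2; apply: le_trans bs; apply: le_trans _ h2.
by rewrite le_eqVlt; apply/orP; left; apply/eqP; field.
Qed.

End far_cases.

(** * Assembling the estimate *)

Section step_function.
Context {R : realType}.

(** Powers of Lam indexed by the ceiling of t / eps: approaching by 2 eps lowers the ceiling, so the
    value gains at least one factor Lam. *)
Lemma step_function (eps J0 Lam : R) (N : nat) :
  0 < eps -> 0 <= J0 -> 1 <= Lam ->
  exists f : R -> R, [/\ forall t, 0 <= f t <= J0 * Lam ^+ N,
    forall t, N%:R * eps < t -> f t = 0,
    forall t, 0 <= t <= N%:R * eps -> J0 <= f t &
    forall t, 0 < t <= N%:R * eps -> Lam * f t <= f (Num.max (t - 2 * eps) 0)].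
Proof.
move=> e0 J00 L1; have L0 : 0 < Lam by lra.
pose k t := `|Num.ceil (t / eps)|%N.
pose f t := if t <= N%:R * eps then J0 * Lam ^+ (N - k t) else 0.
have Lle (i j : nat) : (i <= j)%N -> Lam ^+ i <= Lam ^+ j by exact: ler_weXn2l.
exists f; split => t.
- rewrite /f; case: ifP => _; last by rewrite lexx mulr_ge0 ?exprn_ge0 ?(ltW L0).
  by rewrite mulr_ge0 ?exprn_ge0 ?(ltW L0)//= ler_wpM2l// Lle// leq_subr.
- by move=> h; rewrite /f leNgt h.
- move=> /andP[t0 tN]; rewrite /f tN -[leLHS]mulr1 ler_wpM2l//.
  exact: exprn_ege1.
- move=> /andP[t0 tN]; set t' := Num.max _ _.
  have t'N : t' <= N%:R * eps.
    by rewrite /t' ge_max mulr_ge0 ?(ltW e0)// andbT; lra.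
  have t'0 : 0 <= t' by rewrite /t' le_max lexx orbT.
  rewrite /f tN t'N mulrCA -exprS ler_wpM2l// Lle//.
  have kt0 : 0 <= Num.ceil (t / eps).
    by rewrite ceil_ge0 (lt_le_trans (ltrN10 R))// divr_ge0// ltW.
  have kt1 : 0 < Num.ceil (t / eps).
    by rewrite ltNge ceil_le_int -ltNge divr_gt0.
  have kt0' : 0 <= Num.ceil (t' / eps).
    by rewrite ceil_ge0 (lt_le_trans (ltrN10 R))// divr_ge0// ltW.
  have ktN : Num.ceil (t / eps) <= N%:Z.
    by rewrite ceil_le_int ler_pdivrMr.
  (* Only a drop by one is claimed: when the distance is cut off at 0, the ceiling may have been
     1. *)
  have kk : Num.ceil (t' / eps) <= Num.ceil (t / eps) - 1.
    rewrite /t'; case: (leP (t - 2 * eps) 0) => _.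
      by rewrite mul0r ceil0; lia.
    rewrite ceil_le_int rmorphB/= mulrBl mulfK ?gt_eqF//.
    by have := ceil_ge (t / eps); lra.
  move: kt0 kt1 kt0' ktN kk; rewrite /k.
  move: (Num.ceil _) (Num.ceil _) => a b; lia.
Qed.

End step_function.

(** * Near-optimal moves and points away from the boundary *)

Section extended_dpp.
Context {R : realType} {T : Type}.

(** The first index nearly attains the supremum, the second the infimum. Both are finite: an
    infinite supremum or infimum would make the right side infinite, also by the convention that +oo
    plus -oo is -oo. *)
Lemma half_sup_inf (A : set T) (f : T -> R) (w eta : R) : A !=set0 -> 0 < eta ->
  (w%:E = (2^-1)%:E * (ereal_sup [set (f i)%:E | i in A] +
                       ereal_inf [set (f i)%:E | i in A]))%E ->
  (exists2 i, A i & forall j, A j -> w <= (f i + f j) / 2 + eta) /\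
  (exists2 i, A i & forall j, A j -> (f i + f j) / 2 - eta <= w).
Proof.
move=> [i0 Ai0] eta0 wE.
have supge i : A i -> ((f i)%:E <= ereal_sup [set (f i)%:E | i in A])%E.
  by move=> Ai; apply: ereal_sup_ubound; exists i.
have infle i : A i -> (ereal_inf [set (f i)%:E | i in A] <= (f i)%:E)%E.
  by move=> Ai; apply: ereal_inf_lbound; exists i.
move: wE supge infle.
case supE : (ereal_sup [set (f i)%:E | i in A]) => [s| |]; last first.
- by move=> _ /(_ _ Ai0).
- case: (ereal_inf _) => [i| |] //=; last 2 first.
  + by move=> _ _ /(_ _ Ai0).
  + by rewrite /= mulrNy gtr0_sg ?invr_gt0// mul1e.
  by rewrite /= mulry gtr0_sg ?invr_gt0// mul1e.
case infE : (ereal_inf [set (f i)%:E | i in A]) => [i| |]; last first.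
- by rewrite /= mulrNy gtr0_sg ?invr_gt0// mul1e.
- by move=> _ _ /(_ _ Ai0).
rewrite -EFinD -EFinM => -[wE] supge infle.
have fins : ereal_sup [set (f i)%:E | i in A] \is a fin_num by rewrite supE.
have fini : ereal_inf [set (f i)%:E | i in A] \is a fin_num by rewrite infE.
have [_ [a Aa <-]] := ub_ereal_sup_adherent eta0 fins.
have [_ [b Ab <-]] := lb_ereal_inf_adherent eta0 fini.
rewrite supE infE -EFinD -EFinB !lte_fin => bi sa; split.
  exists a => // j Aj; have := infle j Aj; rewrite lee_fin wE; lra.
exists b => // j Aj; have := supge j Aj; rewrite lee_fin wE; lra.
Qed.

End extended_dpp.

Section domain_boundary.
Context {R : realType} {m : nat}.

(** Needed because [inf] of the empty set is 0, which would put all of Omega into the strip. Without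
    boundary Omega is open and closed, so it contains a whole line and is unbounded. *)
Lemma boundary_nonempty (Omega : set 'rV[R]_m.+1) :
  domain Omega -> bounded_set Omega -> boundary Omega !=set0.
Proof.
move=> [[x Ox] oO _] bO; apply/set0P/negP => /eqP b0.
have iO : interior Omega = Omega by apply/interior_id.
have cO : closed Omega.
  move=> y cy; apply: contrapT => Oy; have : boundary Omega y by split; rewrite ?iO.
  by rewrite b0.
pose g (t : R) : 'rV[R]_m.+1 := x + t *: delta_mx 0 0.
have cg : continuous g.
  by move=> t; apply: cvgD; [exact: cvg_cst|apply: cvgZl; exact: cvg_id].
have gT : g @^-1` Omega = setT.
  have /connected_intervalP cT : is_interval [set: R] by [].
  apply: cT.
  - by exists 0; rewrite /g /= scale0r addr0.
  - exists (g @^-1` Omega); last by rewrite setTI.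
    by move/continuousP: cg; apply.
  - exists (g @^-1` Omega); last by rewrite setTI.
    by move/continuous_closedP: cg; apply.
case: bO => M [Mr MO].
set e := (delta_mx 0 0 : 'rV[R]_m.+1) in g cg gT *.
have e0 : 0 < `|e|.
  rewrite normr_gt0; apply/eqP => /matrixP /(_ 0 0) /eqP.
  by rewrite !mxE !eqxx oner_eq0.
(* Large enough that |g t| >= |t e| - |x| = |M| + 2. *)
pose t := (`|x| + `|M| + 2) / `|e|.
have Og : Omega (g t) by have : (g @^-1` Omega) t by rewrite gT.
have MM : M < `|M| + 1 by rewrite (le_lt_trans (ler_norm M))// ltrDl.
have gM : `|g t| <= `|M| + 1 := MO _ MM _ Og.
have := lerB_normD (t *: e) x; rewrite (_ : t *: e + x = g t); last exact: addrC.
rewrite mx_normZ ger0_norm ?divr_ge0 ?addr_ge0// divfK ?gt_eqF//.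
move: gM; move: (`|g t|) (`|x|) (`|M|) => a b c; lra.
Qed.

(** A boundary point of the open set Omega is not in Omega, hence lies outside the ball of radius 2
    r; the triangle inequality does the rest. *)
Lemma edist_boundary (Omega : set 'rV[R]_m.+1) (x0 x : 'rV[R]_m.+1) (r eps : R) :
  domain Omega -> bounded_set Omega -> eball x0 (2 * r) `<=` Omega ->
  0 < eps -> enorm (x - x0) <= 2 * r - eps ->
  (Omega `\` boundary_strip Omega eps) x.
Proof.
move=> dO bO BO e0 xr; split; first by apply: BO; rewrite /eball/=; lra.
move=> [_]; apply/negP; rewrite -leNgt; apply: lb_le_inf.
  by have [y By] := boundary_nonempty dO bO; exists (enorm (x - y)); exists y.
move=> _ [y [cy iy] <-].
have oO : open Omega by case: dO.
have yB : ~ eball x0 (2 * r) y.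
  by move=> /BO Oy; apply: iy; rewrite (iffLR (interior_id _) oO).
have : 2 * r <= enorm (y - x0) by rewrite leNgt; apply/negP.
have : enorm (y - x0) <= enorm (x - y) + enorm (x - x0).
  by rewrite (enormB x y) (le_trans _ (enormD _ _))// addrA subrK.
by move: xr; atoms_lra.
Qed.

End domain_boundary.

(** * The improvement at a pair of points *)

Section hoelder_core.
Context {R : realType} {m : nat}.
Variables (u al : 'rV[R]_m.+1 -> R) (x0 : 'rV[R]_m.+1).
Variables (r M a0 g eps tau T C Lam : R) (N : nat).
(** With this coefficient D (r / 2)^2 = 2 M, the bound for the oscillation of u. *)
Local Notation D := (8 * M / r ^+ 2).

(** The order of choice is tau and T, then N, C, and Lam last. The two lower bounds on C serve the
    misaligned and the aligned case, Lam the close points; eps does not occur. *)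
Definition admissible_constants : Prop :=
  [/\ [/\ (0 < m)%N, 0 < r, 0 <= M, 0 < a0 & 0 < g < 1],
      tau = (1 - g) * a0 / 16,
      [/\ 4 <= N%:R :> R, 64 <= (1 - g) * a0 * N%:R ^+ 2 &
          16 <= N%:R * (a0 * tau ^+ 2)],
      T = 1 + 4 * r &
      [/\ 0 <= C,
        6 * D * r + 1 <= C * (g / 8) * a0 * tau ^+ 2 / T,
        2 * D + 1 <= C * (g / 2) * ((1 - g) * a0) / T ^+ 2 &
        Lam = 2 * (6 * D * r + C * (N%:R + 2) + 2) / a0]].

Definition game_setting : Prop :=
  [/\ [/\ 0 < eps, eps < 1 & eps <= r / 2],
    forall x, eball x0 (2 * r) x -> `|u x| <= M,
    forall x z : 'rV[R]_m.+1, eball x0 (2 * r) x -> eball x0 (2 * r) z ->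
      a0 <= al x <= 1 /\ g * al x <= al z,
    forall x nu : 'rV[R]_m.+1, enorm (x - x0) <= 2 * r - eps -> enorm nu = eps ->
      W_well_defined eps u x nu &
    forall (x : 'rV[R]_m.+1) (eta : R), enorm (x - x0) <= 2 * r - eps -> 0 < eta ->
    (exists2 nu, enorm nu = eps & forall mu, enorm mu = eps ->
      u x <= (mixed_value (al x) eps u x nu + mixed_value (al x) eps u x mu) / 2
             + eta) /\
    (exists2 nu, enorm nu = eps & forall mu, enorm mu = eps ->
      (mixed_value (al x) eps u x nu + mixed_value (al x) eps u x mu) / 2 - eta
        <= u x)].

Lemma pair_improvement (K : R) (f2 : R -> R) (x1 z1 x z : 'rV[R]_m.+1) :
  admissible_constants -> game_setting ->
  (forall t : R, 0 <= f2 t) ->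
  (forall t : R, N%:R * eps < t -> f2 t = 0) ->
  (forall t : R, 0 <= t <= N%:R * eps -> eps `^ g <= f2 t) ->
  (forall t : R, 0 < t <= N%:R * eps -> Lam * f2 t <= f2 (Num.max (t - 2 * eps) 0)) ->
  x != z -> enorm (x - x0) <= 2 * r - eps -> enorm (z - x0) <= 2 * r - eps ->
  enorm (x - x1) <= r -> enorm (z - z1) <= r ->
  displaced_bound u K C D g eps f2 x1 z1 x z ->
  forall nx nz, enorm nx = eps -> enorm nz = eps ->
  exists mx mz, [/\ enorm mx = eps, enorm mz = eps &
    (mixed_value (al x) eps u x nx - mixed_value (al z) eps u z nz) / 2 +
    (mixed_value (al x) eps u x mx - mixed_value (al z) eps u z mz) / 2 <=
    K + (C * enorm (x - z) `^ g + localizer D x1 z1 x z - f2 (enorm (x - z)))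
      - eps ^+ 2].
Proof.
move=> [[m_gt0 r_gt0 M_ge0 a00 g01] tauE [N4 N_aligned N_misaligned] TE
  [C_ge0 C_misaligned C_aligned LamE]].
move=> [[e0 e1 eps_r] _ al_bounds u_mean _].
move=> f0 f_far f_near f_jump xz xr zr xx1 zz1 HK nx nz nxE nzE.
have D0 : 0 <= D by rewrite divr_ge0 ?sqr_ge0// mulr_ge0.
have Bx : eball x0 (2 * r) x.
  by rewrite /eball/= (le_lt_trans xr)// ltrBlDr ltrDl.
have Bz : eball x0 (2 * r) z.
  by rewrite /eball/= (le_lt_trans zr)// ltrBlDr ltrDl.
have [/andP[ax1 ax2] gxz] := al_bounds _ _ Bx Bz.
have [/andP[az1 az2] gzx] := al_bounds _ _ Bz Bx.
have ax01 : 0 <= al x <= 1 by rewrite ax2 andbT (le_trans (ltW a00)).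
have az01 : 0 <= al z <= 1 by rewrite az2 andbT (le_trans (ltW a00)).
have xi0 : x - z != 0 by rewrite subr_eq0.
have er : 0 < eps <= r by rewrite e0/=; move: eps_r r_gt0; atoms_lra.
have N0 : 0 < N%:R :> R by rewrite (lt_le_trans _ N4).
have S : one_step_setting u K C D g eps r N%:R (al x) (al z) f2 x1 z1 x z.
  split=> //; split=> // nu nuE; split; exact: u_mean.
have t0 : 0 < enorm (x - z) by rewrite enorm_gt0.
have T1 : 1 <= T by rewrite TE; move: r_gt0; atoms_lra.
have tT : enorm (x - z) <= T.
  have : enorm (x - z) <= enorm (x - x0) + enorm (z - x0).
    rewrite (enormB z x0) (le_trans _ (enormD _ _))//.
    by rewrite addrA subrK.
  by rewrite TE; move: xr zr e0; atoms_lra.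
have [tN|tN] := leP (enorm (x - z)) (N%:R * eps).
  have tN' : 0 < enorm (x - z) <= N%:R * eps by rewrite t0.
  have [|mx [mz [mxE mzE H]]] := near_case m_gt0 S tN; last first.
    by exists mx, mz; split=> //; exact: H.
  have fn := f_near _ (_ : 0 <= enorm (x - z) <= N%:R * eps).
  have {}fn : eps `^ g <= f2 (enorm (x - z)) by apply: fn; rewrite ltW.
  have fj := f_jump _ tN'.
  have eg : eps <= eps `^ g.
    by case/andP: g01 => g0 g1; rewrite ger1_powR ?e0 ?(ltW e1)// ltW.
  have e2 : eps ^+ 2 <= eps by rewrite expr2 ler_piMr// ltW.
  have mn : a0 <= Num.min (al x) (al z) by rewrite le_min ax1.
  set t := enorm (x - z) in fn fj t0 *.
  have Dr : 0 <= 6 * D * r by rewrite (mulr_ge0 (mulr_ge0 _ D0) (ltW r_gt0)).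
  have CN : 0 <= C * (N%:R + 2) by rewrite mulr_ge0// addr_ge0.
  (* By the choice of Lam, the middle term is (6 D r + C (N + 2) + 2) f2. As f2 >= eps^g >= eps >=
     eps^2, its four parts dominate the four terms on the left. *)
  apply: (@le_trans _ _ (a0 / 2 * (Lam * f2 t))); last first.
    rewrite ler_pM// ?divr_ge0 ?(ltW a00)//.
      rewrite mulr_ge0 ?f0// LamE divr_ge0 ?(ltW a00)// mulr_ge0//.
      by rewrite (addr_ge0 (addr_ge0 Dr CN)).
    by rewrite ler_pM2r.
  have -> : a0 / 2 * (Lam * f2 t) = (6 * D * r + C * (N%:R + 2) + 2) * f2 t.
    by rewrite LamE; field; rewrite !gt_eqF.
  have h1 : 6 * D * r * eps <= 6 * D * r * f2 t.
    by rewrite ler_wpM2l// (le_trans eg).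
  have h2 : C * (N%:R + 2) * eps `^ g <= C * (N%:R + 2) * f2 t.
    by rewrite ler_wpM2l.
  by move: h1 h2 e2 eg fn; rewrite mulrA; move: (8 * M / r ^+ 2) => D'; atoms_lra.
have tN' := ltW tN; rewrite (f_far _ tN) subr0.
have [h1|h1] := leP (dotp (x - z) nx) ((1 - tau ^+ 2 / 2) * (eps * enorm (x - z))).
  apply: (far_misaligned_case S tN' a00 ax1 az1 (ltW e1) N_misaligned tT T1
    C_misaligned nxE nzE).
  by left.
have [h2|h2] := leP (dotp (x - z) (- nz)) ((1 - tau ^+ 2 / 2) * (eps * enorm (x - z))).
  apply: (far_misaligned_case S tN' a00 ax1 az1 (ltW e1) N_misaligned tT T1
    C_misaligned nxE nzE).
  by right; rewrite lerNl -dotpNr.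
exists (- nx), (- nz); rewrite !enormN; split=> //.
apply: (far_aligned_case S tN' N4 a00 ax1 az1 gxz gzx
  tauE N_aligned tT T1 C_aligned nxE nzE).
  by split; last exact: ltW.
by split; [rewrite enormN|exact: ltW].
Qed.

End hoelder_core.

Section hoelder_estimate.
Context {R : realType} {m : nat}.
Variables (u al : 'rV[R]_m.+1 -> R) (x0 : 'rV[R]_m.+1).
Variables (r M a0 g eps tau T C Lam : R) (N : nat).
Local Notation D := (8 * M / r ^+ 2).

(** Used for (x1, z1) and for (z1, x1), which bounds the absolute value. At the pair itself the
    penalty vanishes, so K <= J is enough. *)
Lemma one_sided_estimate (x1 z1 : 'rV[R]_m.+1) :
  @admissible_constants R m r M a0 g tau T C Lam N ->
  game_setting u al x0 r M a0 g eps ->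
  eball x0 r x1 -> eball x0 r z1 ->
  u x1 - u z1 <= C * enorm (x1 - z1) `^ g + eps `^ g * Lam ^+ N.
Proof.
move=> AC GS Bx1 Bz1.
have [[m_gt0 r_gt0 M_ge0 a00 g01] _ [N4 _ _] _ [C_ge0 _ _ LamE]] := AC.
have [[e0 e1 eps_r] uM al_bounds _ dpp] := GS.
have D0 : 0 <= D by rewrite divr_ge0 ?sqr_ge0// mulr_ge0.
have Bx0 : eball x0 (2 * r) x0 by rewrite /eball/= subrr enorm0 mulr_gt0.
have [/andP[al1 al2] _] := al_bounds _ _ Bx0 Bx0.
have a01 : a0 <= 1 by rewrite (le_trans al1).
have Lam1 : 1 <= Lam.
  have h : 0 <= 6 * D * r + C * (N%:R + 2).
    by rewrite addr_ge0 ?(mulr_ge0 (mulr_ge0 _ D0) (ltW r_gt0))// mulr_ge0// addr_ge0.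
  rewrite LamE ler_pdivlMr// mul1r; move: h a01.
  by move: (6 * _ * _ + _) => k; atoms_lra.
have [f2 [f_bnd f_far f_near f_jump]] :=
  @step_function R eps (eps `^ g) Lam N e0 (powR_ge0 _ _) Lam1.
have f0 t : 0 <= f2 t by case/andP: (f_bnd t).
set J := eps `^ g * Lam ^+ N in f_bnd *.
have fJ t : f2 t <= J by case/andP: (f_bnd t).
pose F (x z : 'rV[R]_m.+1) : R :=
  C * enorm (x - z) `^ g + localizer D x1 z1 x z - f2 (enorm (x - z)).
pose S := [set u v.1 - u v.2 - F v.1 v.2 | v in
  [set v : 'rV[R]_m.+1 * 'rV[R]_m.+1 | eball x0 (2 * r) v.1 /\ eball x0 (2 * r) v.2]].
have r2 x : eball x0 r x -> eball x0 (2 * r) x.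
  by rewrite /eball/= => h; rewrite (lt_le_trans h)// ler_peMl ?(ltW r_gt0)// ler1n.
have L0 (x z : 'rV[R]_m.+1) : 0 <= localizer D x1 z1 x z.
  by rewrite mulr_ge0// addr_ge0// sqr_ge0.
have P0 (x z : 'rV[R]_m.+1) : 0 <= C * enorm (x - z) `^ g.
  by rewrite mulr_ge0// powR_ge0.
have uB x z : eball x0 (2 * r) x -> eball x0 (2 * r) z -> u x - u z <= 2 * M.
  move=> /uM + /uM; rewrite !ler_norml => /andP[_ h1] /andP[h2 _].
  by move: h1 h2; atoms_lra.
have hS : has_sup S.
  split; first by exists (u x1 - u z1 - F x1 z1), (x1, z1) => //; split; exact: r2.
  exists (2 * M + J) => _ [[x z] [/= Bx Bz] <-].
  have := uB _ _ Bx Bz; have := L0 x z; have := P0 x z; have := fJ (enorm (x - z)).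
  by rewrite /F; move: (localizer _ _ _ _ _) => l; atoms_lra.
pose K := sup S.
have KS x z : eball x0 (2 * r) x -> eball x0 (2 * r) z -> u x - u z - F x z <= K.
  by move=> Bx Bz; apply: (ub_le_sup hS.2); exists (x, z).
suff KJ : K <= J.
  have := KS _ _ (r2 _ Bx1) (r2 _ Bz1); have := f0 (enorm (x1 - z1)).
  rewrite /F /localizer !subrr enorm0 expr0n addr0 mulr0 addr0; move: KJ.
  by clearbody K; atoms_lra.
rewrite leNgt; apply/negP => JK.
(* The bound K - J keeps the value at the chosen pair above J, which excludes x = z. With eps^2 / 4
   here and in both uses of the mean value equation, the total error 3 eps^2 / 4 stays below the
   improvement eps^2. *)
pose eta := Num.min (eps ^+ 2 / 4) (K - J).
have eta0 : 0 < eta by rewrite lt_min subr_gt0 JK andbT divr_gt0// exprn_gt0.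
have eta1 : eta <= eps ^+ 2 / 4 by rewrite ge_min lexx.
have eta2 : eta <= K - J by rewrite ge_min lexx orbT.
have [_ [[x z] [/= Bx Bz] <-] Kxz] := sup_adherent eta0 hS.
rewrite -/K in Kxz.
have JF : J < u x - u z - F x z by move: Kxz eta2; clearbody K eta; atoms_lra.
have xz : x != z.
  apply/eqP => xz; move: JF; rewrite xz subrr.
  have := L0 z z; have := P0 z z; have := fJ (enorm (z - z)).
  by rewrite /F; move: (localizer _ _ _ _ _) => l; atoms_lra.
(* A distance of r / 2 or more would make the penalty at least 2 M, while the value of the pair
   exceeds J >= f2. *)
have close : enorm (x - x1) < r / 2 /\ enorm (z - z1) < r / 2.
  have lD : localizer D x1 z1 x z < 2 * M.
    have := uB _ _ Bx Bz; have := P0 x z; have := fJ (enorm (x - z)).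
    by move: JF; rewrite /F; move: (localizer _ _ _ _ _) => l; atoms_lra.
  have far (v : 'rV[R]_m.+1) : r / 2 <= enorm v -> 2 * M <= D * enorm v ^+ 2.
    move=> rv; have -> : 2 * M = D * (r / 2) ^+ 2 by field; rewrite gt_eqF.
    by rewrite ler_wpM2l// ler_sqr ?nnegrE ?enorm_ge0 ?divr_ge0 ?(ltW r_gt0).
  have lx : D * enorm (x - x1) ^+ 2 <= localizer D x1 z1 x z.
    by rewrite ler_wpM2l// lerDl sqr_ge0.
  have lz : D * enorm (z - z1) ^+ 2 <= localizer D x1 z1 x z.
    by rewrite ler_wpM2l// lerDr sqr_ge0.
  split; rewrite ltNge; apply/negP => /far h.
    by have := lt_le_trans lD (le_trans h lx); rewrite ltxx.
  by have := lt_le_trans lD (le_trans h lz); rewrite ltxx.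
have [cx cz] := close.
have in15 (y y1 : 'rV[R]_m.+1) : eball x0 r y1 -> enorm (y - y1) < r / 2 ->
    enorm (y - x0) < 2 * r - eps.
  move=> h0 h2; have h1 : enorm (y1 - x0) < r := h0.
  have : enorm (y - x0) <= enorm (y - y1) + enorm (y1 - x0).
    by rewrite (le_trans _ (enormD _ _))// addrA subrK.
  by move: h1 h2 eps_r; atoms_lra.
have xr' := in15 _ _ Bx1 cx; have zr' := in15 _ _ Bz1 cz.
have xr := ltW xr'; have zr := ltW zr'.
have half_le (y : 'rV[R]_m.+1) : enorm y < r / 2 -> enorm y <= r.
  by move=> h; rewrite (le_trans (ltW h))// ler_pdivrMr// ler_peMr ?(ltW r_gt0)// ler1n.
have HK : displaced_bound u K C D g eps f2 x1 z1 x z.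
  move=> v w ve we.
  have inb (y v' : 'rV[R]_m.+1) : enorm (y - x0) < 2 * r - eps -> enorm v' <= eps ->
      eball x0 (2 * r) (y + v').
    move=> h1 h2; suff : enorm (y + v' - x0) < 2 * r by [].
    have : enorm (y + v' - x0) <= enorm (y - x0) + enorm v'.
      by rewrite addrAC enormD.
    by move: h1 h2; atoms_lra.
  have xv := inb _ _ xr' ve; have zw := inb _ _ zr' we.
  have := KS _ _ xv zw; rewrite /F /localizer.
  rewrite (_ : x + v - (z + w) = x - z + (v - w)); last by rewrite opprD addrACA.
  by clearbody K; atoms_lra.
(* A nearly maximizing move at x and a nearly minimizing one at z; the improvement lemma supplies
   the replies. *)
have [[nx nxE Hx] _] := dpp x (eps ^+ 2 / 4) xr (divr_gt0 (exprn_gt0 2 e0) (ltr0n _ 4)).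
have [_ [nz nzE Hz]] := dpp z (eps ^+ 2 / 4) zr (divr_gt0 (exprn_gt0 2 e0) (ltr0n _ 4)).
have [mx [mz [mxE mzE H]]] := pair_improvement AC GS f0 f_far f_near f_jump xz xr zr
  (half_le _ cx) (half_le _ cz) HK nxE nzE.
have := Hx _ mxE; have := Hz _ mzE; move: H Kxz eta1 (exprn_gt0 2 e0).
rewrite -/(F x z).
by clearbody K eta F; atoms_lra.
Qed.

End hoelder_estimate.

(** * Choice of the constants *)

Section constants.
Context {R : realType}.

Lemma exists_admissible_constants (m : nat) (r M a0 g : R) :
  (0 < m)%N -> 0 < r -> 0 <= M -> 0 < a0 -> 0 < g < 1 ->
  exists tau T C Lam N, 0 <= C /\ 0 <= Lam /\
    @admissible_constants R m r M a0 g tau T C Lam N.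
Proof.
move=> m0 r0 M0 a00 g01; have /andP[g0 g1] := g01.
pose tau := (1 - g) * a0 / 16; pose T := 1 + 4 * r.
pose D := 8 * M / r ^+ 2.
have D0 : 0 <= D by rewrite divr_ge0 ?sqr_ge0// mulr_ge0.
have b0 : 0 < (1 - g) * a0 by rewrite mulr_gt0// subr_gt0.
have tau0 : 0 < tau by rewrite divr_gt0.
have d0 : 0 < a0 * tau ^+ 2 by rewrite mulr_gt0// exprn_gt0.
have T0 : 0 < T by rewrite /T; lra.
(* A sum, so that N dominates each lower bound; the quadratic condition follows from the linear one
   since N >= 1. *)
pose N := (4 + Num.bound (64 / ((1 - g) * a0)) + Num.bound (16 / (a0 * tau ^+ 2)))%N.
have N1 : 64 / ((1 - g) * a0) <= N%:R.
  rewrite (le_trans (ltW (archi_boundP _)))//.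
    by rewrite divr_ge0// ltW.
  by rewrite ler_nat /N addnAC leq_addl.
have N2 : 16 / (a0 * tau ^+ 2) <= N%:R.
  rewrite (le_trans (ltW (archi_boundP _)))//.
    by rewrite divr_ge0// ltW.
  by rewrite ler_nat leq_addl.
have N4 : 4 <= N%:R :> R by rewrite ler_nat /N -addnA leq_addr.
pose c1 := g / 8 * a0 * tau ^+ 2 / T.
pose c2 := g / 2 * ((1 - g) * a0) / T ^+ 2.
have c10 : 0 < c1.
  by rewrite divr_gt0// -mulrA mulr_gt0// divr_gt0.
have c20 : 0 < c2 by rewrite divr_gt0 ?exprn_gt0// mulr_gt0// divr_gt0.
have A1 : 0 <= 6 * D * r + 1.
  by rewrite addr_ge0// (mulr_ge0 (mulr_ge0 _ D0) (ltW r0)).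
have A2 : 0 <= 2 * D + 1 by rewrite addr_ge0// mulr_ge0.
pose C := (6 * D * r + 1) / c1 + (2 * D + 1) / c2.
have C0 : 0 <= C by rewrite addr_ge0// divr_ge0// ltW.
pose Lam := 2 * (6 * D * r + C * (N%:R + 2) + 2) / a0.
exists tau, T, C, Lam, N; split=> //; split.
  rewrite divr_ge0 ?(ltW a00)// mulr_ge0// addr_ge0// addr_ge0//.
    exact: (mulr_ge0 (mulr_ge0 _ D0) (ltW r0)).
  by rewrite mulr_ge0// addr_ge0.
split=> //; split=> //.
- rewrite -ler_pdivrMl// mulrC (le_trans N1)// expr2 ler_peMl// (le_trans _ N4)//.
  by rewrite ler1n.
- by rewrite -ler_pdivrMr.
- rewrite -/D (_ : C * (g / 8) * a0 * tau ^+ 2 / T = C * c1); last first.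
    by rewrite /c1 !mulrA.
  rewrite /C [leRHS]mulrDl (divfK (lt0r_neq0 c10)) lerDl.
  rewrite mulr_ge0 ?(ltW c10)// divr_ge0//.
  exact: ltW.
- rewrite -/D (_ : C * (g / 2) * ((1 - g) * a0) / T ^+ 2 = C * c2); last first.
    by rewrite /c2 !mulrA.
  rewrite /C [leRHS]mulrDl (divfK (lt0r_neq0 c20)) lerDr.
  rewrite mulr_ge0 ?(ltW c20)// divr_ge0//.
  exact: ltW.
Qed.

End constants.

Section exponents.
Context {R : realType} {n : nat}.
Implicit Types (Omega : set 'rV[R]_n) (p : 'rV[R]_n -> R).

Lemma alpha_ge Omega p (pmin : R) x : 1 < pmin ->
  ereal_inf [set (p x)%:E | x in Omega] = pmin%:E -> Omega x ->
  (pmin - 1) / (pmin + n%:R) <= alpha p x <= 1.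
Proof.
move=> p1 pinf Ox.
have px : pmin <= p x.
  by rewrite -lee_fin -pinf; apply: ereal_inf_lbound; exists x.
have n0 : 0 <= n%:R :> R by [].
have d1 : 0 < pmin + n%:R by lra.
have d2 : 0 < p x + n%:R by lra.
rewrite /alpha; apply/andP; split; last by rewrite ler_pdivrMr//; lra.
rewrite ler_pdivrMr// mulrAC ler_pdivlMr//.
nra.
Qed.

(** The condition on gamma gives gamma alpha_max < alpha_min, and this is the only form in which it
    enters the game. *)
Lemma alpha_ratio Omega p (pmin kappa gamma : R) : 1 < pmin -> Omega !=set0 ->
  ereal_inf [set (p x)%:E | x in Omega] = pmin%:E ->
  0 < kappa -> 0 < gamma < alpha_min Omega p / alpha_max Omega p - kappa ->
  gamma < 1 /\
  forall x z, Omega x -> Omega z -> gamma * alpha p x <= alpha p z.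
Proof.
move=> p1 [y Oy] pinf k0 /andP[g0 gk].
have a00 : 0 < (pmin - 1) / (pmin + n%:R).
  by rewrite divr_gt0//; have := ler0n R n; lra.
have al x : Omega x -> 0 < alpha p x <= 1.
  by move=> /(alpha_ge p1 pinf)/andP[h ->]; rewrite (lt_le_trans a00).
have amin x : Omega x -> alpha_min Omega p <= alpha p x.
  move=> Ox; apply: ge_inf; last by exists x.
  by exists 0 => _ [z Oz <-]; have /andP[/ltW] := al _ Oz.
have amax x : Omega x -> alpha p x <= alpha_max Omega p.
  move=> Ox; apply: ub_le_sup; last by exists x.
  by exists 1 => _ [z Oz <-]; have /andP[_] := al _ Oz.
have M0 : 0 < alpha_max Omega p.
  by have /andP[h _] := al _ Oy; exact: (lt_le_trans h (amax _ Oy)).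
have gA : gamma < alpha_min Omega p / alpha_max Omega p by lra.
move: gA; rewrite ltr_pdivlMr// => gA; split=> [|x z Ox Oz].
  have := amin _ Oy; have := amax _ Oy => h1 h2.
  have : gamma * alpha_max Omega p < 1 * alpha_max Omega p.
    by rewrite mul1r (lt_le_trans gA)// (le_trans h2).
  by rewrite ltr_pM2r.
apply: le_trans (ltW (lt_le_trans gA (amin _ Oz))).
by rewrite ler_wpM2l ?(ltW g0)// amax.
Qed.

End exponents.

Theorem theorem4p1 (R : realType) (n : nat) (pmin pmax r M gamma : R)
    (n_ge2 : (2 <= n)%N) (pmin_gt1 : 1 < pmin) (r_gt0 : 0 < r) :
  exists C : R,
    forall (Omega : set 'rV[R]_n) (p u : 'rV[R]_n -> R) (x0 : 'rV[R]_n)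
           (kappa eps : R),
    domain Omega ->
    bounded_set Omega ->
    {within closure Omega, continuous p} ->
    ereal_inf [set (p x)%:E | x in Omega] = pmin%:E ->
    ereal_sup [set (p x)%:E | x in Omega] = pmax%:E ->
    eball x0 (2 * r) `<=` Omega ->
    0 < kappa < alpha_min Omega p / alpha_max Omega p ->
    0 < gamma < alpha_min Omega p / alpha_max Omega p - kappa ->
    0 < eps < 1 ->
    lebesgue_measurable_fun (closure Omega) u ->
    (forall x nu, (Omega `\` boundary_strip Omega eps) x -> enorm nu = eps ->
       W_well_defined eps u x nu) ->
    ereal_sup [set `|u x|%:E | x in eball x0 (2 * r)] = M%:E ->
    satisfies_dpp Omega p eps u ->
    forall x z, eball x0 r x -> eball x0 r z ->
      `|u x - u z| <= C * (enorm (x - z) `^ gamma / r `^ gamma)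
                      + C * (eps `^ gamma / r `^ gamma).
Proof.
case: n n_ge2 => [//|m] m_gt0.
pose a0 := (pmin - 1) / (pmin + m.+1%:R).
have a00 : 0 < a0 by rewrite divr_gt0//; have := ler0n R m.+1; lra.
(* C is fixed before Omega, p and u, so M and gamma may be incompatible with them; then the
   remaining hypotheses are contradictory and C = 0 serves. *)
have [/andP[M0 /andP[g0 g1]]|bad] := boolP ((0 <= M) && (0 < gamma < 1)); last first.
  exists 0 => Omega p u x0 kappa eps dO _ _ pinf _ BO /andP[k0 _] gk _ _ _ uM _.
  have [On0 _ _] := dO; have [g1 _] := alpha_ratio pmin_gt1 On0 pinf k0 gk.
  move: bad; case/andP: gk => -> _; rewrite g1 !andbT => /negP[].
  rewrite -lee_fin -uM; apply: (@le_trans _ _ `|u x0|%:E); first by rewrite lee_fin.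
  by apply: ereal_sup_ubound; exists x0 => //; rewrite /eball/= subrr enorm0 mulr_gt0.
have g01 : 0 < gamma < 1 by rewrite g0.
have [tau [T [C [Lam [N [C0 [Lam0 AC]]]]]]] :=
  exists_admissible_constants m_gt0 r_gt0 M0 a00 g01.
have rg0 : 0 < r `^ gamma by rewrite powR_gt0.
(* The first summand is for the term in |x - z|, the second for the maximum of the step function,
   the third for eps > r / 2. *)
exists (C * r `^ gamma + Lam ^+ N * r `^ gamma + 4 * M).
move=> Omega p u x0 kappa eps dO bO _ pinf _ BO /andP[k0 _] gk /andP[e0 e1] _ Wd uM dpp.
have [On0 _ _] := dO; have [_ ratio] := alpha_ratio pmin_gt1 On0 pinf k0 gk.
have uB x : eball x0 (2 * r) x -> `|u x| <= M.
  by move=> Bx; rewrite -lee_fin -uM; apply: ereal_sup_ubound; exists x.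
set Cf := C * r `^ gamma + _ + _.
have LN0 : 0 <= Lam ^+ N by rewrite exprn_ge0.
have CLM : [/\ 0 <= C * r `^ gamma, 0 <= Lam ^+ N * r `^ gamma & 0 <= 4 * M].
  by rewrite !mulr_ge0// ltW.
have [h1 h2 h3] := CLM.
have q0 (y : 'rV[R]_m.+1) : 0 <= enorm y `^ gamma / r `^ gamma.
  by rewrite divr_ge0 ?powR_ge0.
have qe0 : 0 <= eps `^ gamma / r `^ gamma by rewrite divr_ge0 ?powR_ge0.
have r2 x : eball x0 r x -> eball x0 (2 * r) x.
  by rewrite /eball/= => h; rewrite (lt_le_trans h)// ler_peMl ?(ltW r_gt0)// ler1n.
(* For eps > r / 2 the oscillation bound 2 M suffices: r^gamma <= (2 eps)^gamma <= 2 eps^gamma. *)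
have [er|er] := leP eps (r / 2); last first.
  move=> x z Bx Bz; apply: (@le_trans _ _ (Cf * (eps `^ gamma / r `^ gamma))).
    have uu : `|u x - u z| <= 2 * M.
      rewrite (le_trans (ler_normB _ _))//.
      by have := uB _ (r2 _ Bx); have := uB _ (r2 _ Bz); lra.
    apply: (le_trans uu); apply: (@le_trans _ _ (4 * M * (eps `^ gamma / r `^ gamma))).
      have -> : 2 * M = 4 * M * 2^-1 by field.
      rewrite ler_wpM2l// ler_pdivlMr// mulrC ler_pdivrMr//.
      apply: (@le_trans _ _ ((2 * eps) `^ gamma)).
        rewrite ge0_ler_powR ?nnegrE ?(ltW r_gt0) ?(ltW g0) ?mulr_ge0 ?(ltW e0)//.
        by move: er; rewrite ltr_pdivrMr// mulrC => /ltW.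
      rewrite powRM ?(ltW e0)// mulrC ler_wpM2l ?powR_ge0//.
      by rewrite ler1_powR ?ler1n// ltW.
    by rewrite ler_wpM2r// /Cf lerDr addr_ge0.
  by rewrite lerDr mulr_ge0// /Cf !addr_ge0.
have GS : game_setting u (alpha p) x0 r M a0 gamma eps.
  split=> //.
  - move=> x z Bx Bz; split; first exact: (alpha_ge pmin_gt1 pinf (BO _ Bx)).
    exact: ratio (BO _ Bx) (BO _ Bz).
  - by move=> x nu xr; apply: Wd; exact: (edist_boundary dO bO BO).
  - move=> x eta xr eta0; have Ox := edist_boundary dO bO BO e0 xr.
    apply: (half_sup_inf _ eta0 (dpp x Ox)).
    exists (eps *: delta_mx 0 0).
    by rewrite /= enormZ enorm_delta mulr1 gtr0_norm.
move=> x z Bx Bz.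
have H1 := one_sided_estimate AC GS Bx Bz; have H2 := one_sided_estimate AC GS Bz Bx.
rewrite enormB in H2.
apply: (@le_trans _ _ (C * enorm (x - z) `^ gamma + eps `^ gamma * Lam ^+ N)).
  by rewrite ler_norml; apply/andP; split => //; rewrite lerNl opprB.
apply: lerD.
  have -> : C * enorm (x - z) `^ gamma =
    C * r `^ gamma * (enorm (x - z) `^ gamma / r `^ gamma).
    by field; rewrite gt_eqF.
  by rewrite ler_wpM2r// /Cf -addrA lerDl addr_ge0.
have -> : eps `^ gamma * Lam ^+ N = Lam ^+ N * r `^ gamma * (eps `^ gamma / r `^ gamma).
  by field; rewrite gt_eqF.
by rewrite ler_wpM2r// /Cf addrAC lerDr addr_ge0.
Qed.
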